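(* Let $(X,\Omega)$ be a measurable space, let $E$ be a $\sigma$-Dedekind complete vector lattice, and let $\mu\colon\Omega\to\overline{E^+}$ be a measure. Then the following are equivalent: (1) $I_\mu\colon\mathcal L^1(X,\Omega,\mu;\mathbb R)\to E$ is a vector lattice homomorphism; (2) $\mu(\Delta_1\cap\Delta_2)=\mu(\Delta_1)\wedge\mu(\Delta_2)$ in $E$ for all $\Delta_1,\Delta_2\in\Omega$ with finite measure; (3) $\mu(\Delta_1\cup\Delta_2)=\mu(\Delta_1)\vee\mu(\Delta_2)$ in $E$ for all $\Delta_1,\Delta_2\in\Omega$ with finite measure. When $\mu$ is finite, these are also equivalent to: (4) $I_\mu\colon\mathcal B(X,\Omega;\mathbb R)\to E$ is a vector lattice homomorphism. If $I_\mu\colon\mathcal L^1(X,\Omega,\mu;\mathbb R)\to E$ is a vector lattice homomorphism, then the kernel of $I_\mu$ is $\mathcal N(X,\Omega,\mu;\mathbb R)$, so that the induced map $I_\mu\colon L^1(X,\Omega,\mu;\mathbb R)\to E$ is an injective vector lattice homomorphism. The space $L^1(X,\Omega,\mu;\mathbb R)$ is then $\sigma$-Dedekind complete, and $I_\mu\colon L^1(X,\Omega,\mu;\mathbb R)\to E$ is $\sigma$-order continuous. If, in addition, $E$ is monotone complete and has the countable sup property, then $L^1(X,\Omega,\mu;\mathbb R)$ is Dedekind complete, it has the countable sup property, and $I_\mu\colon L^1(X,\Omega,\mu;\mathbb R)\to E$ is order continuous.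
   Context: All vector spaces are over $\mathbb R$; $\mathbb R^+=[0,\infty)$; vector lattices are supposed to be Archimedean. $x_\lambda\uparrow x$ (resp. $x_\lambda\downarrow x$) means that $(x_\lambda)$ is an increasing (resp. decreasing) net with supremum (resp. infimum) $x$. $E$ is monotone complete if every increasing net that is bounded above has a supremum; a vector lattice is ($\sigma$-)Dedekind complete if every non-empty (countable) subset that is bounded above has a supremum. $E$ has the countable sup property if, for every net $(x_\lambda)\subseteq E^+$ and $x\in E^+$ with $x_\lambda\uparrow x$, there is a countable set of indices $\{\lambda_n\}$ with $x=\sup_n x_{\lambda_n}$. A positive operator $T$ is order continuous (resp. $\sigma$-order continuous) if $Tx_\lambda\downarrow0$ for every net (resp. sequence) with $x_\lambda\downarrow 0$. $\overline E=E\cup\{\infty\}$ with $\infty$ as largest element, and $\overline{E^+}=E^+\cup\{\infty\}$ with the obvious addition and action of $\mathbb R^+$. A measure $\mu\colon\Omega\to\overline{E^+}$ is a map with $\mu(\emptyset)=0$ and $\mu(\bigcup_n\Delta_n)=\bigvee_{N}\sum_{n=1}^N\mu(\Delta_n)$ in $\overline E$ for every pairwise disjoint sequence in the $\sigma$-algebra $\Omega$. It is finite if $\mu(X)\in E$; $\Delta$ has finite measure if $\mu(\Delta)\in E$. Order integral: for $\varphi=\sum_{i=1}^n r_i\chi_{\Delta_i}$ with $r_i\in\mathbb R^+$ and disjoint $\Delta_i\in\Omega$, $\int_X^{o}\varphi\,d\mu=\sum r_i\mu(\Delta_i)\in\overline{E^+}$; for measurable $f\colon X\to[0,\infty]$,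 $\int_X^{o}f\,d\mu=\bigvee_n\int_X^{o}\varphi_n\,d\mu$ for any sequence of such $\varphi_n\uparrow f$ pointwise (independent of the choice). $\mathcal L^1(X,\Omega,\mu;\mathbb R)$ consists of the measurable $f\colon X\to\mathbb R$ with $\int_X^{o}|f|\,d\mu\in E$, and then $I_\mu(f)=\int^{o}_X f\,d\mu=\int^{o}_Xf^+\,d\mu-\int^{o}_Xf^-\,d\mu$. $\mathcal B(X,\Omega;\mathbb R)$ is the space of bounded measurable functions. $\mathcal N(X,\Omega,\mu;\mathbb R)$ is the set of measurable functions that vanish $\mu$-almost everywhere, and $L^1(X,\Omega,\mu;\mathbb R)=\mathcal L^1/\mathcal N$; the induced map on it is also denoted by $I_\mu$. *)

(* Defs.v *)
From HB Require Import structures.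
From mathcomp Require Import all_boot all_order all_algebra.
From mathcomp Require Import generic_quotient.
From mathcomp Require Import all_classical all_reals all_analysis.
From mathcomp Require Import measurable_realfun.

Set Implicit Arguments.
Unset Strict Implicit.
Unset Printing Implicit Defensive.

Import Order.TTheory GRing.Theory Num.Theory.
Import numFieldNormedType.Exports HBSimple HBNNSimple.

Local Open Scope classical_set_scope.
Local Open Scope ring_scope.

(* The library's lattice structure [Order.Lattice] cannot be joined with
   [GRing.Lmodule] after [Num.RealDomain] has been declared, so the lattice
   operations, which are determined by the order, are part of this mixin. *)
HB.mixin Record isVectorLattice (R : realType) E
    of GRing.Lmodule R E & Order.POrder ring_display E := {
  vmeet : E -> E -> E ;
  vjoin : E -> E -> E ;
  vlexI : forall x y z : E, (x <= vmeet y z) = (x <= y) && (x <= z) ;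
  vleUx : forall x y z : E, (vjoin x y <= z) = (x <= z) && (y <= z) ;
  vlerD2r : forall x y z : E, x <= y -> x + z <= y + z ;
  vlerZ : forall (a : R) (x y : E), 0 <= a -> x <= y -> a *: x <= a *: y ;
  (* Archimedean: inf_n x/(n+1) = 0 for all positive x *)
  vlarchi : forall x y : E, 0 <= x ->
    (forall n : nat, y <= n.+1%:R^-1 *: x) -> y <= 0
}.

#[short(type="vectorLatticeType")]
HB.structure Definition VectorLattice (R : realType) :=
  { E of GRing.Lmodule R E & Order.POrder ring_display E &
         isVectorLattice R E }.

(* A subset [A] is regarded as a partially ordered set in its own right:
  suprema and infima are taken in [A], not in the ambient type.  The case
  [A = setT] gives the notions for the type itself. *)

Section order_notions.
Context {disp : Order.disp_t} {T : porderType disp}.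
Implicit Types (A S : set T) (s : T).

Definition sup_in A S s :=
  [/\ A s, ubound S s & forall t, A t -> ubound S t -> (s <= t)%O].

Definition inf_in A S s :=
  [/\ A s, lbound S s & forall t, A t -> lbound S t -> (t <= s)%O].

Definition dedekind_complete A := forall S, S `<=` A -> S !=set0 ->
  (exists2 u, A u & ubound S u) -> exists s, sup_in A S s.

Definition sigma_dedekind_complete A := forall S, S `<=` A -> S !=set0 ->
  countable S -> (exists2 u, A u & ubound S u) -> exists s, sup_in A S s.

Record directed (I : Type) (leI : I -> I -> Prop) : Prop := Directed {
  directed_inhabited : inhabited I ;
  directed_refl : forall i, leI i i ;
  directed_trans : forall i j k, leI i j -> leI j k -> leI i k ;
  directed_ub : forall i j, exists2 k, leI i k & leI j k }.

Definition increasing_net (I : Type) (leI : I -> I -> Prop) (x : I -> T) :=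
  directed leI /\ forall i j, leI i j -> (x i <= x j)%O.

Definition decreasing_net (I : Type) (leI : I -> I -> Prop) (x : I -> T) :=
  directed leI /\ forall i j, leI i j -> (x j <= x i)%O.

Definition net_up A (I : Type) (leI : I -> I -> Prop) (x : I -> T) s :=
  [/\ increasing_net leI x, range x `<=` A & sup_in A (range x) s].

Definition net_down A (I : Type) (leI : I -> I -> Prop) (x : I -> T) s :=
  [/\ decreasing_net leI x, range x `<=` A & inf_in A (range x) s].

Definition monotone_complete A :=
  forall (I : Type) (leI : I -> I -> Prop) (x : I -> T),
    increasing_net leI x -> range x `<=` A ->
    (exists2 u, A u & ubound (range x) u) -> exists s, sup_in A (range x) s.

End order_notions.

Section vector_lattice_notions.
Context {R : realType} {V W : vectorLatticeType R}.
Implicit Types (A : set V) (T : V -> W).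

Definition vector_sublattice A :=
  [/\ A 0,
      forall (a : R) x y, A x -> A y -> A (a *: x + y),
      forall x y, A x -> A y -> A (vjoin x y)
    & forall x y, A x -> A y -> A (vmeet x y)].

(* Being a homomorphism on A includes that A is a vector lattice. *)
Definition vector_lattice_hom A T :=
  [/\ vector_sublattice A,
      forall (a : R) x y, A x -> A y -> T (a *: x + y) = a *: T x + T y,
      forall x y, A x -> A y -> T (vjoin x y) = vjoin (T x) (T y)
    & forall x y, A x -> A y -> T (vmeet x y) = vmeet (T x) (T y)].

Definition countable_sup_property A :=
  forall (I : Type) (leI : I -> I -> Prop) (x : I -> V) (s : V),
    (forall i, 0 <= x i) -> 0 <= s -> net_up A leI x s ->
    exists l : nat -> I, sup_in A (range (x \o l)) s.

(* Stated for positive T, such as vector lattice homomorphisms. *)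
Definition order_continuous A T :=
  forall (I : Type) (leI : I -> I -> Prop) (x : I -> V),
    net_down A leI x 0 -> net_down setT leI (T \o x) 0.

Definition sigma_order_continuous A T := forall x : nat -> V,
  net_down A (fun m n : nat => (m <= n)%N) x 0 ->
  net_down setT (fun m n : nat => (m <= n)%N) (T \o x) 0.

End vector_lattice_notions.

Variant with_infty (E : Type) := Fin of E | Infty.
Arguments Infty {E}.

Section extended.

Definition option_of_ext E (x : with_infty E) :=
  if x is Fin e then Some e else None.
Definition ext_of_option E (x : option E) :=
  if x is Some e then Fin e else Infty.
Lemma option_of_extK E : cancel (@option_of_ext E) (@ext_of_option E).
Proof. by case. Qed.

HB.instance Definition _ (E : eqType) :=
  Equality.copy (with_infty E) (can_type (@option_of_extK E)).
HB.instance Definition _ (E : choiceType) :=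
  Choice.copy (with_infty E) (can_type (@option_of_extK E)).

Section addition.
Variable E : nmodType.
Implicit Types x y z : with_infty E.

Definition ext_add x y :=
  match x, y with Fin a, Fin b => Fin (a + b) | _, _ => Infty end.

Lemma ext_addA : associative ext_add.
Proof. by move=> [a|] [b|] [c|] //=; rewrite addrA. Qed.
Lemma ext_addC : commutative ext_add.
Proof. by move=> [a|] [b|] //=; rewrite addrC. Qed.
Lemma ext_add0 : left_id (Fin 0) ext_add.
Proof. by move=> [a|] //=; rewrite add0r. Qed.

HB.instance Definition _ :=
  GRing.isNmodule.Build (with_infty E) ext_addA ext_addC ext_add0.

End addition.

Section order.
Context {disp : Order.disp_t} {E : porderType disp}.
Implicit Types x y z : with_infty E.

Definition ext_le x y :=
  match x, y with
  | _, Infty => true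
  | Infty, Fin _ => false
  | Fin a, Fin b => (a <= b)%O
  end.

Lemma ext_le_refl : reflexive ext_le.
Proof. by case=> /=. Qed.
Lemma ext_le_anti : antisymmetric ext_le.
Proof. by move=> [a|] [b|] //= /le_anti ->. Qed.
Lemma ext_le_trans : transitive ext_le.
Proof. by move=> [a|] [b|] [c|] //=; exact: le_trans. Qed.

HB.instance Definition _ := Order.Le_isPOrder.Build disp (with_infty E)
  ext_le_refl ext_le_anti ext_le_trans.

End order.

(* Only used for r >= 0; the convention is 0 * oo = 0. *)
Definition ext_scale (R : realType) (E : lmodType R) (r : R)
    (x : with_infty E) : with_infty E :=
  match x with Fin e => Fin (r *: e) | Infty => if r == 0 then 0 else Infty end.

Definition ext_finite E (x : with_infty E) := exists e, x = Fin e.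

(* Junk value 0 at oo; only used on finite elements. *)
Definition ext_fine (E : nmodType) (x : with_infty E) : E :=
  if x is Fin e then e else 0.

End extended.

Record vmeasure d (X : measurableType d) (R : realType)
    (E : vectorLatticeType R) := VMeasure {
  vmeas :> set X -> with_infty E ;
  vmeas0 : vmeas set0 = 0 ;
  (* The values on non-measurable sets are irrelevant. *)
  vmeas_ge0 : forall A, measurable A -> Fin 0 <= vmeas A ;
  vmeas_sigma_additive : forall F : nat -> set X,
    (forall n, measurable (F n)) -> trivIset setT F ->
    supremums (range (fun N => \sum_(n < N) vmeas (F n)))
              (vmeas (\bigcup_n F n)) }.

Section vmeasure_theory.
Context d (X : measurableType d) (R : realType) (E : vectorLatticeType R).
Variable mu : vmeasure X E.

Lemma vmeas_le A B : measurable A -> measurable B -> A `<=` B -> mu A <= mu B.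
Proof.
move=> mA mB AB.
pose F n := if n is 0%N then A else if n is 1%N then B `\` A else set0.
have mF n : measurable (F n).
  by case: n => [|[|n]] //=; exact: measurableD.
have tF : trivIset setT F.
  apply/trivIsetP => -[|[|i]] [|[|j]] _ _ //= _;
    rewrite ?set0I ?setI0 ?setDIK// setIC setDIK //.
have FB : \bigcup_n F n = B.
  apply/seteqP; split => x.
    by case=> -[|[|n]] _ //=; [exact: AB | case].
  move=> Bx; have [Ax|nAx] := pselect (A x); first by exists 0%N.
  by exists 1%N.
have [/= ubF _] := vmeas_sigma_additive mu mF tF.
rewrite FB in ubF; apply: ubF => /=; exists 1%N => //.
by rewrite big_ord_recr big_ord0 /= add0r.
Qed.

Definition vnull (N : set X) :=
  exists A, [/\ measurable A, mu A = 0 & N `<=` A].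

Definition valmost_everywhere (P : X -> Prop) := vnull [set x | ~ P x].

Lemma vnull_bigcup (N : nat -> set X) :
  (forall n, vnull (N n)) -> vnull (\bigcup_n N n).
Proof.
move=> /choice[A hA].
have mA n : measurable (A n) by case: (hA n).
have mD n : measurable (seqDU A n) by exact: seqDU_measurable.
have mu0 n : mu (seqDU A n) = 0.
  apply/eqP; rewrite eq_le vmeas_ge0// andbT.
  have [_ <- _] := hA n; apply: vmeas_le => //.
  exact: subset_seqDU.
exists (\bigcup_n A n); split.
- exact: bigcupT_measurable.
- rewrite seqDU_bigcup_eq.
  have [_] := vmeas_sigma_additive mu mD (@trivIset_seqDU _ A).
  move=> /(_ 0) h; apply/eqP; rewrite eq_le vmeas_ge0//; last first.
    exact: bigcupT_measurable.
  rewrite andbT; apply: h => _ /= [n _ <-].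
  by rewrite big1.
- move=> x [n _ Nx]; exists n => //; have [_ _] := hA n; exact.
Qed.

Lemma vae_all (P : nat -> X -> Prop) :
  (forall n, valmost_everywhere (P n)) ->
  valmost_everywhere (fun x => forall n, P n x).
Proof.
move=> /vnull_bigcup[A [mA A0 hA]]; exists A; split => // x /= nP.
by apply: hA; apply: contrapT => h; apply: nP => n; apply: contrapT => nPn;
  apply: h; exists n.
Qed.

Lemma vae_imp (P Q : X -> Prop) : (forall x, P x -> Q x) ->
  valmost_everywhere P -> valmost_everywhere Q.
Proof.
move=> PQ [A [mA A0 hA]]; exists A; split => // x nQ; apply: hA => /PQ.
exact: nQ.
Qed.

Lemma vae_and (P Q : X -> Prop) :
  valmost_everywhere P -> valmost_everywhere Q ->
  valmost_everywhere (fun x => P x /\ Q x).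
Proof.
move=> hP hQ.
have h n : valmost_everywhere ((fun n x => if n is 0%N then P x else Q x) n).
  by case: n.
apply: vae_imp (vae_all h) => x hx; split; [exact: (hx 0%N)|exact: (hx 1%N)].
Qed.

Lemma vae_true (P : X -> Prop) : (forall x, P x) -> valmost_everywhere P.
Proof.
by move=> h; exists set0; split; [|exact: vmeas0|move=> x /=; apply].
Qed.

(* The integral of sum_i r_i chi_(D_i), with disjoint D_i, does not depend on
   the representation; the one with the r_i the values of phi is used here. *)
Definition simple_ointegral (phi : {nnsfun X >-> R}) : with_infty E :=
  \sum_(r \in range phi) ext_scale r (mu (phi @^-1` [set r])).

Definition is_ointegral (f : X -> \bar R) (v : with_infty E) :=
  exists phi : nat -> {nnsfun X >-> R},
    [/\ forall x, nondecreasing_seq (fun n => phi n x),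
        forall x, (phi n x)%:E @[n --> \oo] --> f x
      & supremums (range (fun n => simple_ointegral (phi n))) v].

(* The value does not depend on the sequence of simple functions, so [xget]
   merely picks the unique [v] such that [is_ointegral f v]. *)
Definition ointegral (f : X -> \bar R) : with_infty E :=
  xget Infty (is_ointegral f).

Definition calL1 : set {mfun X >-> R} :=
  [set f | ext_finite (ointegral (fun x => `|f x|%:E))].

Definition Iint (f : {mfun X >-> R}) : E :=
  ext_fine (ointegral (fun x => (f^\+ x)%:E))
  - ext_fine (ointegral (fun x => (f^\- x)%:E)).

Definition calN : set {mfun X >-> R} :=
  [set f | valmost_everywhere (fun x => f x = 0)].

End vmeasure_theory.
Arguments calL1 {d X R E} mu _.
Arguments calN {d X R E} mu _.

Definition bounded_mfun d (X : measurableType d) (R : realType) :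
    set {mfun X >-> R} :=
  [set f | exists M : R, forall x, `|f x| <= M].
Arguments bounded_mfun {d} X R _.

Section mfun_vector_lattice.
Context d (X : measurableType d) (R : realType).
Implicit Types f g h : {mfun X >-> R}.

Definition mfun_le f g := `[< forall x, f x <= g x >].

Lemma mfun_le_refl : reflexive mfun_le.
Proof. by move=> f; apply/asboolP. Qed.
Lemma mfun_le_anti : antisymmetric mfun_le.
Proof.
move=> f g /andP[/asboolP fg /asboolP gf].
by apply/mfuneqP => x; apply/le_anti; rewrite fg gf.
Qed.
Lemma mfun_le_trans : transitive mfun_le.
Proof.
move=> f g h /asboolP fg /asboolP gh; apply/asboolP => x.
exact: le_trans (fg x) (gh x).
Qed.

HB.instance Definition _ := Order.Le_isPOrder.Build ring_display
  {mfun X >-> R} mfun_le_refl mfun_le_anti mfun_le_trans.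

Lemma mfun_leP f g : reflect (forall x, f x <= g x) (f <= g).
Proof. exact: asboolP. Qed.

Lemma mfun_meetP f g h : (f <= min_mfun g h) = (f <= g) && (f <= h).
Proof.
apply/mfun_leP/andP => [H|[/mfun_leP fg /mfun_leP fh] x /=].
  by split; apply/mfun_leP => x; have := H x; rewrite /= le_min => /andP[].
by rewrite le_min fg fh.
Qed.

Lemma mfun_joinP f g h : (max_mfun f g <= h) = (f <= h) && (g <= h).
Proof.
apply/mfun_leP/andP => [H|[/mfun_leP fh /mfun_leP gh] x /=].
  by split; apply/mfun_leP => x; have := H x; rewrite /= ge_max => /andP[].
by rewrite ge_max fh gh.
Qed.

Lemma real_archi (x y : R) : (forall n : nat, y <= n.+1%:R^-1 * x) -> y <= 0.
Proof.
move=> h; rewrite leNgt; apply/negP => y0.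
have x0 : 0 < x by apply: lt_le_trans y0 _; have := h 0%N; rewrite invr1 mul1r.
have /ltr_add_invr[n] : 0 < y / x by rewrite divr_gt0.
rewrite add0r ltr_pdivlMr// => /lt_le_trans /(_ (h n)).
by rewrite ltxx.
Qed.

Lemma mfun_lerD f g h : f <= g -> f + h <= g + h.
Proof. by move=> /mfun_leP fg; apply/mfun_leP => x /=; rewrite lerD2r. Qed.
Lemma mfun_lerZ (a : R) f g : 0 <= a -> f <= g -> a *: f <= a *: g.
Proof. by move=> a0 /mfun_leP fg; apply/mfun_leP => x; exact: (ler_wpM2l a0 (fg x)). Qed.
Lemma mfun_archi f g : 0 <= f ->
  (forall n : nat, g <= n.+1%:R^-1 *: f) -> g <= 0.
Proof.
move=> _ h; apply/mfun_leP => x; apply: (@real_archi (f x)) => n.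
by have /mfun_leP/(_ x) := h n.
Qed.

HB.instance Definition _ := isVectorLattice.Build R {mfun X >-> R}
  mfun_meetP mfun_joinP  mfun_lerD mfun_lerZ mfun_archi.

End mfun_vector_lattice.

(* [L0 mu] is the vector lattice of all measurable functions modulo [calN mu];
  [L1 mu], the image of [calL1 mu] in it, is [calL1 mu / calN mu]. *)

Section L0.
Context d (X : measurableType d) (R : realType) (E : vectorLatticeType R).
Variable mu : vmeasure X E.
Implicit Types f g h : {mfun X >-> R}.

Local Notation ae := (valmost_everywhere mu).

Definition vae_eq f g := `[< ae (fun x => f x = g x) >].

Lemma vae_eq_refl : reflexive vae_eq.
Proof. by move=> f; apply/asboolP/vae_true. Qed.
Lemma vae_eq_sym : symmetric vae_eq.
Proof.
by move=> f g; apply/asboolP/asboolP; apply: vae_imp => x ->.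
Qed.
Lemma vae_eq_trans : transitive vae_eq.
Proof.
move=> g f h /asboolP fg /asboolP gh; apply/asboolP.
by apply: vae_imp (vae_and fg gh) => x [-> ->].
Qed.

Canonical vae_eq_equiv := EquivRel vae_eq vae_eq_refl vae_eq_sym vae_eq_trans.

Local Open Scope quotient_scope.

Definition L0 : Type := {eq_quot vae_eq}.
HB.instance Definition _ := Choice.on L0.
HB.instance Definition _ := EqQuotient.on L0.

Implicit Types u v w : L0.

Lemma L0_eqP f g : ae (fun x => f x = g x) <-> \pi_L0 f = \pi_L0 g.
Proof.
split=> [h|/eqP]; first by apply/eqP; rewrite eqmodE; apply/asboolP.
by rewrite eqmodE => /asboolP.
Qed.

Variant L0_spec : L0 -> Type := L0Spec f : L0_spec (\pi_L0 f).
Lemma L0P u : L0_spec u.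
Proof. by rewrite -[u]reprK. Qed.

Lemma ae_repr f : ae (fun x => repr (\pi_L0 f) x = f x).
Proof. by apply/L0_eqP; rewrite reprK. Qed.

Definition L0_zero : L0 := \pi_L0 0.
Definition L0_opp u : L0 := \pi_L0 (- repr u).
Definition L0_add u v : L0 := \pi_L0 (repr u + repr v).
Definition L0_scale (a : R) u : L0 := \pi_L0 (a *: repr u).
Definition L0_le u v := `[< ae (fun x => repr u x <= repr v x) >].
Definition L0_meet u v : L0 := \pi_L0 (vmeet (repr u) (repr v)).
Definition L0_join u v : L0 := \pi_L0 (vjoin (repr u) (repr v)).

Lemma L0_oppE f : L0_opp (\pi_L0 f) = \pi_L0 (- f).
Proof.
apply/L0_eqP; apply: vae_imp (ae_repr f) => x hx.
by change (- repr (\pi_L0 f) x = - f x); rewrite hx.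
Qed.
Lemma L0_addE f g : L0_add (\pi_L0 f) (\pi_L0 g) = \pi_L0 (f + g).
Proof.
apply/L0_eqP; apply: vae_imp (vae_and (ae_repr f) (ae_repr g)) => x [hf hg].
by change (((repr (\pi_L0 f) x) + (repr (\pi_L0 g) x))
  = ((f x) + (g x))); rewrite hf hg.
Qed.
Lemma L0_scaleE a f : L0_scale a (\pi_L0 f) = \pi_L0 (a *: f).
Proof.
apply/L0_eqP; apply: vae_imp (ae_repr f) => x hx.
by change (a * repr (\pi_L0 f) x = a * f x); rewrite hx.
Qed.
Lemma L0_meetE f g : L0_meet (\pi_L0 f) (\pi_L0 g) = \pi_L0 (vmeet f g).
Proof.
apply/L0_eqP; apply: vae_imp (vae_and (ae_repr f) (ae_repr g)) => x [hf hg].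
by change (Num.min (repr (\pi_L0 f) x) (repr (\pi_L0 g) x)
  = Num.min (f x) (g x)); rewrite hf hg.
Qed.
Lemma L0_joinE f g : L0_join (\pi_L0 f) (\pi_L0 g) = \pi_L0 (vjoin f g).
Proof.
apply/L0_eqP; apply: vae_imp (vae_and (ae_repr f) (ae_repr g)) => x [hf hg].
by change (Num.max (repr (\pi_L0 f) x) (repr (\pi_L0 g) x)
  = Num.max (f x) (g x)); rewrite hf hg.
Qed.
Lemma L0_leP f g : reflect (ae (fun x => f x <= g x)) (L0_le (\pi_L0 f) (\pi_L0 g)).
Proof.
have H := vae_and (ae_repr f) (ae_repr g).
apply: (iffP (asboolP _)) => h;
  by apply: vae_imp (vae_and H h) => x [[-> ->]].
Qed.

Lemma L0_addA : associative L0_add.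
Proof.
move=> u v w; case/L0P: u => f; case/L0P: v => g; case/L0P: w => h.
by rewrite !L0_addE addrA.
Qed.
Lemma L0_addC : commutative L0_add.
Proof. by move=> u v; case/L0P: u => f; case/L0P: v => g; rewrite !L0_addE addrC. Qed.
Lemma L0_add0 : left_id L0_zero L0_add.
Proof. by move=> u; case/L0P: u => f; rewrite L0_addE add0r. Qed.
Lemma L0_addN : left_inverse L0_zero L0_opp L0_add.
Proof. by move=> u; case/L0P: u => f; rewrite L0_oppE L0_addE addNr. Qed.

HB.instance Definition _ :=
  GRing.isZmodule.Build L0 L0_addA L0_addC L0_add0 L0_addN.

Lemma L0_piD f g : \pi_L0 f + \pi_L0 g = \pi_L0 (f + g).
Proof. exact: L0_addE. Qed.

Lemma L0_scaleA a b u : L0_scale a (L0_scale b u) = L0_scale (a * b) u.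
Proof. by case/L0P: u => f; rewrite !L0_scaleE scalerA. Qed.
Lemma L0_scale1 : left_id 1 L0_scale.
Proof. by move=> u; case/L0P: u => f; rewrite L0_scaleE scale1r. Qed.
Lemma L0_scaleDr : right_distributive L0_scale +%R.
Proof.
move=> a u v; case/L0P: u => f; case/L0P: v => g.
by rewrite L0_piD !L0_scaleE L0_piD scalerDr.
Qed.
Lemma L0_scaleDl u : {morph L0_scale^~ u : a b / a + b}.
Proof.
move=> a b; case/L0P: u => f /=.
by rewrite !L0_scaleE L0_piD scalerDl.
Qed.

HB.instance Definition _ := GRing.Zmodule_isLmodule.Build R L0
  L0_scaleA L0_scale1 L0_scaleDr L0_scaleDl.

Lemma L0_piZ (a : R) f : a *: \pi_L0 f = \pi_L0 (a *: f).
Proof. exact: L0_scaleE. Qed.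

Lemma L0_le_refl : reflexive L0_le.
Proof. by move=> u; apply/asboolP/vae_true. Qed.
Lemma L0_le_anti : antisymmetric L0_le.
Proof.
move=> u v; case/L0P: u => f; case/L0P: v => g /andP[/L0_leP fg /L0_leP gf].
by apply/L0_eqP; apply: vae_imp (vae_and fg gf) => x [? ?]; apply/le_anti/andP.
Qed.
Lemma L0_le_trans : transitive L0_le.
Proof.
move=> u v w /asboolP uv /asboolP vw; apply/asboolP.
by apply: vae_imp (vae_and uv vw) => x []; exact: le_trans.
Qed.

HB.instance Definition _ := Order.Le_isPOrder.Build ring_display L0
  L0_le_refl L0_le_anti L0_le_trans.

Lemma L0_meetP u v w : (u <= L0_meet v w) = (u <= v) && (u <= w).
Proof.
case/L0P: u => f; case/L0P: v => g; case/L0P: w => h.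
rewrite L0_meetE; apply/L0_leP/andP => [H|[/L0_leP fg /L0_leP fh]].
  by split; apply/L0_leP; apply: vae_imp H => x; rewrite /= le_min => /andP[].
by apply: vae_imp (vae_and fg fh) => x [? ?]; rewrite /= le_min; apply/andP.
Qed.

Lemma L0_joinP u v w : (L0_join u v <= w) = (u <= w) && (v <= w).
Proof.
case/L0P: u => f; case/L0P: v => g; case/L0P: w => h.
rewrite L0_joinE; apply/L0_leP/andP => [H|[/L0_leP fh /L0_leP gh]].
  by split; apply/L0_leP; apply: vae_imp H => x; rewrite /= ge_max => /andP[].
by apply: vae_imp (vae_and fh gh) => x [? ?]; rewrite /= ge_max; apply/andP.
Qed.

Lemma L0_lerD u v w : u <= v -> u + w <= v + w.
Proof.
case/L0P: u => f; case/L0P: v => g; case/L0P: w => h /L0_leP fg.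
rewrite !L0_piD; apply/L0_leP.
by apply: vae_imp fg => x; rewrite /= lerD2r.
Qed.
Lemma L0_lerZ (a : R) u v : 0 <= a -> u <= v -> a *: u <= a *: v.
Proof.
case/L0P: u => f; case/L0P: v => g a0 /L0_leP fg.
rewrite !L0_piZ; apply/L0_leP.
by apply: vae_imp fg => x fgx; exact: (ler_wpM2l a0 fgx).
Qed.
Lemma L0_archi u v : 0 <= u -> (forall n : nat, v <= n.+1%:R^-1 *: u) -> v <= 0.
Proof.
case/L0P: u => f; case/L0P: v => g _ h.
apply/L0_leP; have {}h n : ae (fun x => g x <= n.+1%:R^-1 * f x).
  by have := h n; rewrite L0_piZ => /L0_leP.
by apply: vae_imp (vae_all h) => x; exact: real_archi.
Qed.

HB.instance Definition _ := isVectorLattice.Build R L0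
  L0_meetP L0_joinP L0_lerD L0_lerZ L0_archi.

Definition L1 : set L0 := \pi_L0 @` calL1 mu.

(* On [L1 mu] the value does not depend on the representative. *)
Definition Iint_ae (u : L0) : E := Iint mu (repr u).

End L0.
Arguments L1 {d X R E} mu _.
Arguments Iint_ae {d X R E} mu u.

(* Main.v *)
(* On finite-measure sets, mu(D1 U D2) + mu(D1 n D2) = mu(D1) + mu(D2), while
   in E a \/ b + a /\ b = a + b; so the conditions on unions and intersections
   agree. The condition on intersections makes the integrals of disjoint simple
   functions disjoint in E. By monotone convergence this passes to disjoint
   positive integrable functions, and a linear map on a vector lattice that
   preserves disjointness is a lattice homomorphism.
   A homomorphism I kills f iff it kills f^+ and f^-, and a positive function
   with zero integral vanishes almost everywhere; so I is injective on L^1, and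
   therefore reflects the order. Monotone convergence gives its sigma-order
   continuity. Under the stronger hypotheses on E, the supremum of the image
   of an increasing bounded net is attained along an increasing sequence of
   indices. The supremum of that sequence exists in L^1 and, since I reflects
   the order, it is the supremum of the whole net. *)

Require Import Defs.
From mathcomp Require Import all_boot all_order all_algebra.
From mathcomp Require Import all_classical all_reals all_analysis.
From mathcomp Require Import generic_quotient measurable_realfun ring.

Set Implicit Arguments.
Unset Strict Implicit.
Unset Printing Implicit Defensive.

Import Order.TTheory GRing.Theory Num.Theory.
Import numFieldNormedType.Exports HBSimple HBNNSimple.

Local Open Scope classical_set_scope.
Local Open Scope ring_scope.

(** * Vector lattices *)

Section vector_lattice_theory.
Context {R : realType} {E : vectorLatticeType R}.
Implicit Types (x y z t : E) (a b : R).

Lemma vleD2r z x y : (x + z <= y + z) = (x <= y).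
Proof.
apply/idP/idP => [|h]; last exact: vlerD2r.
by move=> /(@vlerD2r _ _ _ _ (- z)); rewrite !addrK.
Qed.

Lemma vleD2l z x y : (z + x <= z + y) = (x <= y).
Proof. by rewrite ![z + _]addrC vleD2r. Qed.

Lemma vleD x y z t : x <= y -> z <= t -> x + z <= y + t.
Proof. by move=> xy zt; apply: (@le_trans _ _ (y + z));
  rewrite ?vleD2r ?vleD2l. Qed.

Lemma vleBlDr x y z : (x - z <= y) = (x <= y + z).
Proof. by rewrite -(vleD2r z (x - z)) subrK. Qed.

Lemma vleBrDr x y z : (x <= y - z) = (x + z <= y).
Proof. by rewrite -(vleD2r z x) subrK. Qed.

Lemma vsub_ge0 x y : (0 <= y - x) = (x <= y).
Proof. by rewrite vleBrDr add0r. Qed.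

Lemma vleN2 x y : (- x <= - y) = (y <= x).
Proof. by rewrite -(vleD2r x (- x)) addNr addrC vsub_ge0. Qed.

Lemma vaddr_ge0 x y : 0 <= x -> 0 <= y -> 0 <= x + y.
Proof. by move=> x0 y0; rewrite -[0]addr0; exact: vleD. Qed.

Lemma vscaler_ge0 a x : 0 <= a -> 0 <= x -> 0 <= a *: x.
Proof. by move=> a0 h; rewrite -(scaler0 _ a) vlerZ. Qed.

Lemma vleZ_pos a x y : 0 < a -> (a *: x <= a *: y) = (x <= y).
Proof.
move=> a0; apply/idP/idP; last exact/vlerZ/ltW.
move=> h; have := @vlerZ _ _ a^-1 _ _ _ h; rewrite !scalerA mulVf ?gt_eqF//.
by rewrite !scale1r; apply; rewrite invr_ge0 ltW.
Qed.

Lemma vleIl x y : vmeet x y <= x.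
Proof. by have := lexx (vmeet x y); rewrite vlexI => /andP[]. Qed.
Lemma vleIr x y : vmeet x y <= y.
Proof. by have := lexx (vmeet x y); rewrite vlexI => /andP[]. Qed.
Lemma vleUl x y : x <= vjoin x y.
Proof. by have := lexx (vjoin x y); rewrite vleUx => /andP[]. Qed.
Lemma vleUr x y : y <= vjoin x y.
Proof. by have := lexx (vjoin x y); rewrite vleUx => /andP[]. Qed.

Lemma vmeetC x y : vmeet x y = vmeet y x.
Proof. by apply/le_anti; rewrite !vlexI !vleIl !vleIr. Qed.

Lemma vmeet_l x y : x <= y -> vmeet x y = x.
Proof. by move=> xy; apply/le_anti; rewrite vleIl vlexI lexx xy. Qed.

Lemma vjoin_l x y : y <= x -> vjoin x y = x.
Proof. by move=> xy; apply/le_anti; rewrite vleUl vleUx lexx xy. Qed.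

Lemma vleI2 x y z t : x <= y -> z <= t -> vmeet x z <= vmeet y t.
Proof.
by move=> xy zt; rewrite vlexI (le_trans (vleIl _ _) xy) (le_trans (vleIr _ _)
  zt).
Qed.

Lemma vmeetDr x y z : vmeet x y + z = vmeet (x + z) (y + z).
Proof.
apply/le_anti; rewrite vlexI !vleD2r vleIl vleIr/= -vleBlDr vlexI !vleBlDr.
by rewrite vleIl vleIr.
Qed.

Lemma vmeetD_join x y : vmeet x y + vjoin x y = x + y.
Proof.
apply/le_anti/andP; split.
- rewrite addrC -vleBrDr vleUx !vleBrDr vleD2l vleIr/= addrC vleD2r.
  exact: vleIl.
- rewrite -vleBlDr vlexI !vleBlDr vleD2l vleUr/= addrC vleD2l.
  exact: vleUl.
Qed.

Lemma vjoinE x y : vjoin x y = x + y - vmeet x y.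
Proof. by rewrite -(vmeetD_join x) addrAC subrr add0r. Qed.

Lemma vsub_meet_disjoint x y : vmeet (x - vmeet x y) (y - vmeet x y) = 0.
Proof. by rewrite -vmeetDr subrr. Qed.

Lemma vdisjoint_le x y z t :
  0 <= x -> x <= z -> 0 <= y -> y <= t -> vmeet z t = 0 -> vmeet x y = 0.
Proof.
move=> x0 xz y0 yt zt; apply/le_anti; rewrite vlexI x0 y0 /= andbT -zt.
exact: vleI2.
Qed.

(** With [w] the meet of [x] and [y + z], the element [w - z] lies below both [x] and [y], so
    [w <= z]; then [w] lies below both [x] and [z]. *)
Lemma vdisjointD x y z : 0 <= x -> 0 <= y -> 0 <= z ->
  vmeet x y = 0 -> vmeet x z = 0 -> vmeet x (y + z) = 0.
Proof.
move=> x0 y0 z0 xy xz; apply/le_anti; rewrite vlexI x0 vaddr_ge0//= andbT -xz.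
rewrite vlexI vleIl /= -[leRHS]add0r -vleBlDr -xy vlexI !vleBlDr vleIr andbT.
by rewrite (le_trans (vleIl _ _))// -[leLHS]addr0 vleD2l.
Qed.

(** Enlarge both elements by the same factor [a + 1 > 0]: scaling by it is an order automorphism,
    hence preserves disjointness. *)
Lemma vdisjointZ a x y : 0 <= a -> 0 <= x -> 0 <= y ->
  vmeet x y = 0 -> vmeet x (a *: y) = 0.
Proof.
move=> a0 x0 y0 xy.
have b0 : 0 < a + 1 by rewrite ltr_wpDl.
apply: (@vdisjoint_le _ _ ((a + 1) *: x) ((a + 1) *: y)) => //.
- by rewrite scalerDl scale1r -[leLHS]add0r vleD2r vscaler_ge0.
- exact: vscaler_ge0.
- by rewrite scalerDl scale1r -[leLHS]addr0 vleD2l.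
- apply/le_anti/andP; split; last by rewrite vlexI !vscaler_ge0// ltW.
  have -> : vmeet ((a + 1) *: x) ((a + 1) *: y) =
      (a + 1) *: ((a + 1)^-1 *: vmeet ((a + 1) *: x) ((a + 1) *: y)).
    by rewrite scalerA mulfV ?scale1r// gt_eqF.
  rewrite -[leRHS](scaler0 _ (a + 1)) vleZ_pos// -xy vlexI.
  by rewrite -(vleZ_pos _ x b0) -(vleZ_pos _ y b0) scalerA mulfV ?gt_eqF//
    scale1r vleIl vleIr.
Qed.

Lemma varchi_mul x y : (forall c : R, 0 < c -> c < 1 -> c *: x <= y) ->
  0 <= x ->
  x <= y.
Proof.
move=> h x0; rewrite -[y]add0r -vleBlDr; apply: (@vlarchi _ _ x) => // n.
rewrite vleBlDr addrC -vleBlDr -{1}(scale1r x) -scalerBl.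
(* The factor is [c = 1 - 1/(n+1)]. For [n = 0] it is [0], outside the range of the hypothesis, so
   [1/2] is used there together with [0 <= x]. *)
have [->|n0] := eqVneq n 0%N.
  rewrite invr1 subrr scale0r.
  apply: le_trans (h 2^-1 _ _);
    rewrite ?vscaler_ge0 ?invr_gt0 ?invf_lt1 ?ltr1n //.
apply: h; first by rewrite subr_gt0 invf_lt1// ltr1n ltnS lt0n.
by rewrite ltrBlDr ltrDl invr_gt0.
Qed.

End vector_lattice_theory.

(** * Homomorphisms and disjointness preserving maps *)

Section vector_lattice_homs.
Context {R : realType} {V W : vectorLatticeType R}.
Variables (A : set V) (T : V -> W).

Lemma vector_sublatticeB x y : vector_sublattice A -> A x -> A y -> A (x - y).
Proof. by move=> [A0 AD _ _] Ax Ay; rewrite addrC -scaleN1r; apply: AD. Qed.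

Lemma vector_sublatticeD x y : vector_sublattice A -> A x -> A y -> A (x + y).
Proof. by move=> [A0 AD _ _] Ax Ay; rewrite -[x]scale1r; apply: AD. Qed.

Hypothesis linT : forall (a : R) x y, A x -> A y ->
  T (a *: x + y) = a *: T x + T y.

Lemma vhomD x y : A x -> A y -> T (x + y) = T x + T y.
Proof. by move=> Ax Ay; rewrite -[x in LHS]scale1r linT// scale1r. Qed.

Lemma vhomB x y : A x -> A y -> T (x - y) = T x - T y.
Proof. by move=> Ax Ay; rewrite addrC -scaleN1r linT// scaleN1r addrC. Qed.

(** Subtracting the meet from [x] and from [y] leaves disjoint elements. Their images are disjoint,
    and translating back by the image of the meet shows that [T] preserves meets; joins follow from
    [x + y] minus the meet. *)
Lemma vector_lattice_hom_disjoint : vector_sublattice A ->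
  (forall x y, A x -> A y -> vmeet x y = 0 -> vmeet (T x) (T y) = 0) ->
  vector_lattice_hom A T.
Proof.
move=> subA disjT; have [A0 AD AU AI] := subA.
have TI x y : A x -> A y -> T (vmeet x y) = vmeet (T x) (T y).
  move=> Ax Ay; have Axy := AI _ _ Ax Ay.
  have := disjT _ _ (vector_sublatticeB subA Ax Axy)
    (vector_sublatticeB subA Ay Axy) (vsub_meet_disjoint _ _).
  by rewrite !vhomB// -vmeetDr => /eqP; rewrite subr_eq0 => /eqP.
split=> // x y Ax Ay; have Axy := AI _ _ Ax Ay.
by rewrite !vjoinE vhomB ?vhomD ?TI//; exact: vector_sublatticeD.
Qed.

End vector_lattice_homs.

(** * The extended cone *)

Section extended_theory.
Context {R : realType} {E : vectorLatticeType R}.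
Implicit Types (x y z t : with_infty E) (a b r s : R) (e : E).

Lemma ext_le_Fin x e : x <= Fin e -> exists2 e', x = Fin e' & e' <= e.
Proof. by case: x => [e'|//] h; exists e'. Qed.

Lemma ext_FinD e1 e2 : Fin e1 + Fin e2 = Fin (e1 + e2). Proof. by []. Qed.

Lemma ext_add_Fin x y e : x + y = Fin e ->
  exists e1 e2, [/\ x = Fin e1, y = Fin e2 & e = e1 + e2].
Proof. by case: x y => [e1|] [e2|] //= [<-]; exists e1, e2. Qed.

Lemma ext_leD x y z t : x <= y -> z <= t -> x + z <= y + t.
Proof. by case: x y z t => [?|] [?|] [?|] [?|] //=; exact: vleD. Qed.

Lemma ext_addr_ge0 x y : Fin 0 <= x -> Fin 0 <= y -> Fin 0 <= x + y.
Proof. by move=> x0 y0; have := ext_leD x0 y0; rewrite ext_FinD addr0. Qed.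

Lemma ext_sumr_ge0 (I : Type) (l : seq I) (P : pred I)
  (F : I -> with_infty E) :
  (forall i, P i -> Fin 0 <= F i) -> Fin 0 <= \sum_(i <- l | P i) F i.
Proof. by move=> F0; elim/big_ind: _ => //; exact: ext_addr_ge0. Qed.

Lemma ext_ler_sum (I : Type) (l : seq I) (F G : I -> with_infty E) :
  (forall i, F i <= G i) -> \sum_(i <- l) F i <= \sum_(i <- l) G i.
Proof. by move=> FG; elim/big_ind2: _ => // *; exact: ext_leD. Qed.

Lemma ext_leZ r x y : 0 <= r -> x <= y -> ext_scale r x <= ext_scale r y.
Proof.
case: x y => [?|] [?|] //= r0; first exact: vlerZ.
by case: eqP => // -> _; rewrite scale0r.
Qed.

Lemma ext_scale0 r : ext_scale r (0 : with_infty E) = 0.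
Proof. by rewrite /ext_scale/= scaler0. Qed.

Lemma ext_0scale x : ext_scale 0 x = 0.
Proof. by case: x => [e|] /=; rewrite ?scale0r// eqxx. Qed.

Lemma ext_scale1 x : ext_scale 1 x = x.
Proof. by case: x => [e|] /=; rewrite ?scale1r// oner_eq0. Qed.

Lemma ext_scale_ge0 r x : 0 <= r -> Fin 0 <= x -> Fin 0 <= ext_scale r x.
Proof. by move=> r0 x0; have := ext_leZ r0 x0; rewrite ext_scale0. Qed.

Lemma ext_leZl r s x : 0 <= r -> r <= s -> Fin 0 <= x ->
  ext_scale r x <= ext_scale s x.
Proof.
case: x => [e|] r0 rs x0; last first.
  rewrite /ext_scale; have [s0|_] := eqVneq s 0;
    last by case: (if _ then _ else _).
  have -> : r = 0 by apply/le_anti; rewrite r0 -{1}s0 rs.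
  by rewrite eqxx.
by change (r *: e <= s *: e);
  rewrite -vsub_ge0 -scalerBl vscaler_ge0// subr_ge0.
Qed.

Lemma ext_scaleDr r x y : ext_scale r (x + y) = ext_scale r x + ext_scale r y.
Proof.
have [->|/negbTE rn0] := eqVneq r 0; first by rewrite !ext_0scale addr0.
by case: x y => [?|] [?|] /=; rewrite ?rn0// ext_FinD scalerDr.
Qed.

Lemma ext_scaleDl r s x : 0 <= r -> 0 <= s ->
  ext_scale (r + s) x = ext_scale r x + ext_scale s x.
Proof.
case: x => [e|] r0 s0 /=; first by rewrite ext_FinD scalerDl.
rewrite paddr_eq0//; have [_|_] := eqVneq r 0; last by [].
by case: (_ == _) => //=; rewrite addr0.
Qed.

Lemma ext_scaleA r s x : ext_scale r (ext_scale s x) = ext_scale (r * s) x.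
Proof.
case: x => [e|] /=; first by rewrite scalerA.
rewrite mulf_eq0; case: (eqVneq s 0) => [_|_] /=; last by rewrite orbF.
by rewrite scaler0 orbT.
Qed.

Lemma ext_scale_sum r (I : Type) (l : seq I) (P : pred I)
  (F : I -> with_infty E) :
  ext_scale r (\sum_(i <- l | P i) F i) = \sum_(i <- l | P i) ext_scale r (F i).
Proof. exact: (big_morph _ (ext_scaleDr r) (ext_scale0 r)). Qed.

Lemma ext_scale_Fin r x e : ext_scale r x = Fin e ->
  r = 0 \/ exists2 e', x = Fin e' & e = r *: e'.
Proof.
by case: x => [e'|] /=; [case=> <-; right; exists e' | case: eqP => //; left].
Qed.

(** Monotonicity makes a bound [e] of the diagonal sums a bound of all [u m + w n]. If [e] is
    finite, subtraction is available: [y <= e - u m] for each [m], and then [x <= e - y]. *)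
Lemma ext_supD (u w : nat -> with_infty E) x y :
  nondecreasing_seq u -> nondecreasing_seq w ->
  supremums (range u) x -> supremums (range w) y ->
  supremums (range (fun n => u n + w n)) (x + y).
Proof.
move=> ndu ndw [ubx lbx] [uby lby]; split.
  by move=> _ [n _ <-]; apply: ext_leD; [apply: ubx|apply: uby]; exists n.
move=> [e ub_e|//]; last by case: (x + y).
have le_e m n : u m + w n <= Fin e.
  apply: (@le_trans _ _ (u (maxn m n) + w (maxn m n))).
    by apply: ext_leD; [apply: ndu|apply: ndw]; rewrite ?leq_maxl ?leq_maxr.
  by apply: ub_e; exists (maxn m n).
have fin m n : exists e1 e2, [/\ u m = Fin e1, w n = Fin e2 & e1 + e2 <= e].
  have [e' /ext_add_Fin[e1 [e2 [-> -> ->]]]] := ext_le_Fin (le_e m n).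
  by exists e1, e2.
have y_le m e1 : u m = Fin e1 -> y <= Fin (e - e1).
  move=> um; apply: lby => _ [n _ <-].
  have [e1' [e2 []]] := fin m n; rewrite um => -[<-] -> h.
  by change (e2 <= e - e1); rewrite vleBrDr addrC.
have [e0 [_ [u0 _ _]]] := fin 0%N 0%N.
have [ey ye _] := ext_le_Fin (y_le _ _ u0).
have : x <= Fin (e - ey).
  apply: lbx => _ [m _ <-]; have [e1 [_ [um _ _]]] := fin m 0%N; rewrite um.
  have := y_le _ _ um; rewrite ye => h.
  by change (e1 <= e - ey); move: h; rewrite [_ <= _]vleBrDr vleBrDr addrC.
rewrite ye => /ext_le_Fin[ex -> h].
by change (ex + ey <= e); rewrite -vleBrDr.
Qed.

(** For [r > 0] scaling is an order automorphism with inverse [r^-1]. For [r = 0] both sides are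
    [0], by the convention at [Infty]. *)
Lemma ext_supZ r (u : nat -> with_infty E) x : 0 <= r ->
  supremums (range u) x ->
  supremums (range (fun n => ext_scale r (u n))) (ext_scale r x).
Proof.
rewrite le_eqVlt => /orP[/eqP <- _|r0 [ubx lbx]].
  rewrite ext_0scale; split=> [_ [n _ <-]|y h]; first by rewrite ext_0scale.
  by apply: h; exists 0%N => //; rewrite ext_0scale.
split=> [_ [n _ <-]|y h].
  by apply: ext_leZ; [exact: ltW|apply: ubx; exists n].
have rK z : ext_scale r (ext_scale r^-1 z) = z.
  by rewrite ext_scaleA mulfV ?gt_eqF// ext_scale1.
have Kr z : ext_scale r^-1 (ext_scale r z) = z.
  by rewrite ext_scaleA mulVf ?gt_eqF// ext_scale1.
rewrite -(rK y); apply: ext_leZ; first exact: ltW.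
apply: lbx => _ [n _ <-]; rewrite -(Kr (u n)); apply: ext_leZ.
  by rewrite invr_ge0 ltW.
by apply: h; exists n.
Qed.

Lemma ext_sup_sum (I : eqType) (l : seq I) (u : I -> nat -> with_infty E)
    (v : I -> with_infty E) :
  (forall i, i \in l -> nondecreasing_seq (u i)) ->
  (forall i, i \in l -> supremums (range (u i)) (v i)) ->
  supremums (range (fun n => \sum_(i <- l) u i n)) (\sum_(i <- l) v i).
Proof.
elim: l => [|i l IH] ndu supu.
  rewrite big_nil; split=> [_ [n _ <-]|y h]; first by rewrite big_nil.
  by apply: h; exists 0%N => //; rewrite big_nil.
have {}IH := IH (fun j jl => ndu j (mem_behead (s := i :: l) jl))
  (fun j jl => supu j (mem_behead (s := i :: l) jl)).
rewrite big_cons; under eq_fun do rewrite big_cons.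
apply: ext_supD => //; [exact/ndu/mem_head| |exact/supu/mem_head].
move=> m n mn; rewrite !big_seq; elim/big_ind2: _ => // [*|j jl].
  exact: ext_leD.
by apply: ndu => //; rewrite in_cons jl orbT.
Qed.

Lemma ext_sup_unique (A : set (with_infty E)) x y :
  supremums A x -> supremums A y -> x = y.
Proof. by move=> [ubx lbx] [uby lby]; apply/le_anti; rewrite lbx// lby. Qed.

Lemma ext_sup_Fin (u : nat -> E) e :
  supremums (range (fun n => Fin (u n))) (Fin e) <->
  sup_in setT (range u) e.
Proof.
split=> [[ub lb]|[_ ub lb]].
  split=> // [_ [n _ <-]|t _ h]; first by apply: (ub (Fin (u n))); exists n.
  by apply: (lb (Fin t)) => _ [n _ <-]; apply: h; exists n.
split=> [_ [n _ <-]|[t h|//]]; first by apply: ub; exists n.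
by apply: lb => // _ [n _ <-]; apply: (h (Fin (u n))); exists n.
Qed.

Lemma ext_sup_exists (u : nat -> with_infty E) :
  sigma_dedekind_complete [set: E] -> exists x, supremums (range u) x.
Proof.
move=> hE; have [[e ub]|nub] := pselect (exists e, forall n, u n <= Fin e).
  have /choice[w uw] n : exists e', u n = Fin e'.
    by have [e' ->] := ext_le_Fin (ub n); exists e'.
  have -> : u = fun n => Fin (w n) by apply/funext.
  have [||||s sups] := hE (range w); last by exists (Fin s); apply/ext_sup_Fin.
  - by [].
  - by exists (w 0%N), 0%N.
  - exact: card_image_le.
  - by exists e => // _ [n _ <-]; have := ub n; rewrite uw.
exists Infty; split=> [x _|[e h|//]]; first by case: x.
by exfalso; apply: nub; exists e => n; apply: h; exists n.
Qed.

(** Void when one element is [Infty], so that disjointness can be carried through sums and suprema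
    without first proving them finite. *)
Definition ext_disjoint x y := forall e1 e2,
  x = Fin e1 -> y = Fin e2 -> vmeet e1 e2 = 0.

Lemma ext_disjointC x y : ext_disjoint x y -> ext_disjoint y x.
Proof. by move=> h e1 e2 x1 y2; rewrite vmeetC; exact: h. Qed.

Lemma ext_disjoint0 x : Fin 0 <= x -> ext_disjoint x 0.
Proof. by move=> x0 e1 e2 xe [<-]; rewrite vmeetC vmeet_l//; move: x0;
  rewrite xe. Qed.

Lemma ext_disjointD x y z : Fin 0 <= x -> Fin 0 <= y -> Fin 0 <= z ->
  ext_disjoint x y -> ext_disjoint x z -> ext_disjoint x (y + z).
Proof.
move=> x0 y0 z0 xy xz e1 e xe /ext_add_Fin[e2 [e3 [ye ze ->]]].
by apply: vdisjointD; [move: x0|move: y0|move: z0|exact: xy|exact: xz];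
  rewrite ?xe ?ye ?ze.
Qed.

Lemma ext_disjointZ r x y : 0 <= r -> Fin 0 <= x -> Fin 0 <= y ->
  ext_disjoint x y -> ext_disjoint x (ext_scale r y).
Proof.
move=> r0 x0 y0 xy; have [->|] := eqVneq r 0.
  by rewrite ext_0scale; exact: ext_disjoint0.
move=> rn0 e1 e xe /ext_scale_Fin[/eqP|[e2 ye ->]];
  first by rewrite (negbTE rn0).
apply: vdisjointZ => //; [move: x0|move: y0|exact: xy]; by rewrite ?xe ?ye.
Qed.

Lemma ext_disjoint_sum (I : Type) (l : seq I) (F : I -> with_infty E) x :
  Fin 0 <= x -> (forall i, Fin 0 <= F i) -> (forall i, ext_disjoint x (F i)) ->
  ext_disjoint x (\sum_(i <- l) F i).
Proof.
move=> x0 F0 xF; elim: l => [|i l IH].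
  by rewrite big_nil; exact: ext_disjoint0.
rewrite big_cons; apply: ext_disjointD => //.
by apply: ext_sumr_ge0.
Qed.

(* From [t <= y] follows [t - (y - u n) <= u n], so [x] meets [t] in at most
   [y - u n]. *)
Lemma ext_disjoint_sup (u : nat -> with_infty E) x y : Fin 0 <= x ->
  (forall n, Fin 0 <= u n) -> (forall n, ext_disjoint x (u n)) ->
  supremums (range u) y -> ext_disjoint x y.
Proof.
move=> x0 u0 xu [ub lb] a b xa yb.
have a0 : 0 <= a by move: x0; rewrite xa.
have b0 : 0 <= b.
  have : Fin 0 <= y by apply: le_trans (u0 0%N) _; apply: ub; exists 0%N.
  by rewrite yb.
apply/le_anti; rewrite vlexI a0 b0 /= andbT.
have : y <= Fin (b - vmeet a b).
  apply: lb => _ [n _ <-].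
  have : u n <= y by apply: ub; exists n.
  rewrite yb => /ext_le_Fin[c uc cb]; rewrite uc.
  change (c <= b - vmeet a b); rewrite vleBrDr addrC -vleBrDr.
  rewrite -[leRHS]addr0 -(xu n _ _ xa uc) addrC -vleBlDr vlexI.
  by rewrite !vleBlDr (addrC c) subrK vleIr andbT (le_trans (vleIl _ _))//
    -[leLHS]addr0 vleD2l vsub_ge0.
by rewrite yb => h; have : b <= b - vmeet a b by [];
  rewrite vleBrDr -[leRHS]addr0 vleD2l.
Qed.

End extended_theory.

(** * Vector measures and simple functions *)

Section measure_theory.
Context d (X : measurableType d) (R : realType) (E : vectorLatticeType R).
Variable mu : vmeasure X E.
Implicit Types (A B : set X) (phi psi chi : {nnsfun X >-> R}).

Lemma vmeasU A B : measurable A -> measurable B -> A `&` B = set0 ->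
  mu (A `|` B) = mu A + mu B.
Proof.
move=> mA mB AB0; rewrite -bigcup2E.
pose F := bigcup2 A B.
have mF n : measurable (F n) by case: n => [|[|n]];
  [exact: mA|exact: mB|exact: measurable0].
have tF : trivIset setT F.
  by apply/trivIsetP => -[|[|i]] [|[|j]] _ _ //= _;
    rewrite /F/= ?set0I ?setI0// setIC.
have [ub lb] := vmeas_sigma_additive mu mF tF.
have F2 n : \sum_(i < n.+2) mu (F i) = mu A + mu B.
  rewrite 2!big_ord_recl/= addrA big1 ?addr0// => i _; exact: vmeas0.
apply/le_anti/andP; split; last by apply: ub; exists 2%N.
(* The first [n] terms are among the first [n + 2], whose sum is always [mu A + mu B]. *)
apply: lb => _ [n _ <-]; rewrite -(F2 n) -addn2 big_split_ord/=.
rewrite -[X in X <= _]addr0; apply: ext_leD => //; apply: ext_sumr_ge0 => i _.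
exact: vmeas_ge0.
Qed.

Lemma measurable_fibers (T : eqType) (h : X -> T) (s : seq T) :
  (forall t, measurable (h @^-1` [set t])) -> measurable (h @^-1` [set` s]).
Proof.
move=> mh; elim: s => [|t s IH].
  by rewrite (_ : _ @^-1` _ = set0)//; apply/seteqP; split.
rewrite (_ : _ @^-1` _ = h @^-1` [set t] `|` h @^-1` [set` s]).
  exact: measurableU.
apply/seteqP; split=> x /=; rewrite inE; first by case/orP => [/eqP|];
  [left|right].
by case=> [->|->]; rewrite ?eqxx// orbT.
Qed.

Lemma vmeas_fibers (T : eqType) (h : X -> T) (s : seq T) :
  (forall t, measurable (h @^-1` [set t])) -> uniq s ->
  mu (h @^-1` [set` s]) = \sum_(t <- s) mu (h @^-1` [set t]).
Proof.
move=> mh; elim: s => [_|t s IH /= /andP[ts us]].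
  by rewrite big_nil -(vmeas0 mu); congr (mu _); apply/seteqP; split.
rewrite big_cons -IH// -vmeasU//; [|exact: measurable_fibers|].
  congr (mu _); apply/seteqP; split=> x /=; rewrite inE.
    by case/orP => [/eqP|]; [left|right].
  by case=> [->|->]; rewrite ?eqxx// orbT.
by apply/seteqP; split=> x //= -[hx hs]; move: ts; rewrite -hx hs.
Qed.

(** Continuity from below: the successive differences are disjoint, and their first [n + 1] measures
    add up to [mu (F n)]. The empty partial sum is covered by positivity. *)
Lemma vmeas_cvg (F : nat -> set X) : (forall n, measurable (F n)) ->
  nondecreasing_seq F ->
  supremums (range (fun n => mu (F n))) (mu (\bigcup_n F n)).
Proof.
move=> mF ndF.
have mD n : measurable (seqD F n) by rewrite -seqDU_seqD//;
  exact: seqDU_measurable.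
have S n : \sum_(i < n.+1) mu (seqD F i) = mu (F n).
  elim: n => [|n IH]; first by rewrite big_ord1.
  rewrite big_ord_recr/= IH -vmeasU//.
    congr (mu _); rewrite setDUK//; exact/subsetPset/ndF.
  - exact: (mD n.+1).
  - by apply/seteqP; split=> x // [Fx [_]].
have [ub lb] := vmeas_sigma_additive mu mD (trivIset_seqD ndF).
rewrite -eq_bigcup_seqD; split=> [_ [n _ <-]|y h].
  by rewrite -S; apply: ub; exists n.+1.
apply: lb => _ [[|n] _ <-]; last by rewrite S; apply: h; exists n.
rewrite big_ord0; apply: (@le_trans _ _ (mu (F 0%N))); first exact: vmeas_ge0.
by apply: h; exists 0%N.
Qed.

(** * Integrals of simple functions *)

Local Notation sintegral := (simple_ointegral mu).

Definition nnsfun_values phi : seq R := finmap.enum_fset (fset_set (range phi)).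

Lemma nnsfun_values_uniq phi : uniq (nnsfun_values phi).
Proof. exact: finmap.fset_uniq. Qed.

Lemma mem_nnsfun_values phi r :
  reflect (exists x, phi x = r) (r \in nnsfun_values phi).
Proof.
rewrite /nnsfun_values in_fset_set; last exact: fimfunP.
apply: (iffP idP) => [|[x <-]].
  by rewrite inE => -[x _ <-]; exists x.
by rewrite inE; exists x.
Qed.

Lemma nnsfun_values_ge0 phi r : r \in nnsfun_values phi -> 0 <= r.
Proof. by move=> /mem_nnsfun_values[x <-]; exact: fun_ge0. Qed.

Lemma sintegralE phi :
  sintegral phi =
    \sum_(r <- nnsfun_values phi) ext_scale r (mu (phi @^-1` [set r])).
Proof. by rewrite /simple_ointegral fsbig_finite//; exact: fimfunP. Qed.

(** The integral may be computed on any finite measurable partition on whose pieces [phi] is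
    constant; the pieces are coded as the fibres of [h]. Grouping the labels [t] by the value [r t]
    recovers the sum over the range of [phi]. *)
Lemma sintegral_fibers (T : eqType) (h : X -> T) (s : seq T) (r : T -> R) phi :
  (forall t, measurable (h @^-1` [set t])) -> uniq s -> (forall x, h x \in s) ->
  (forall x, phi x = r (h x)) ->
  sintegral phi = \sum_(t <- s) ext_scale (r t) (mu (h @^-1` [set t])).
Proof.
move=> mh us hs phih; rewrite sintegralE.
transitivity (\sum_(a <- nnsfun_values phi) \sum_(t <- s | r t == a)
    ext_scale (r t) (mu (h @^-1` [set t]))).
  apply: eq_bigr => a _.
  transitivity (\sum_(t <- s | r t == a) ext_scale a (mu (h @^-1` [set t]))).
    rewrite -ext_scale_sum -big_filter -vmeas_fibers ?filter_uniq//.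
    congr (ext_scale _ (mu _)); apply/seteqP; split=> x /=;
      rewrite mem_filter phih.
      by move=> ->; rewrite eqxx hs.
    by case/andP => /eqP.
  by apply: eq_bigr => t /eqP ->.
rewrite (exchange_big_dep xpredT)//=; apply: eq_bigr => t _.
(* A label whose value [phi] never takes has an empty fibre and contributes [0]. *)
have [rt|rt] := boolP (r t \in nnsfun_values phi).
  rewrite (eq_bigl (pred1 (r t))) => [|a]; last by rewrite eq_sym.
  by rewrite -big_filter filter_pred1_uniq ?nnsfun_values_uniq// big_seq1.
rewrite (_ : _ @^-1` _ = set0) ?vmeas0 ?ext_scale0 ?big1//.
apply/seteqP; split=> x //= hx; move/negP: rt; apply.
by apply/mem_nnsfun_values; exists x; rewrite phih hx.
Qed.

Section joint.
Variables phi psi : {nnsfun X >-> R}.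

(** The fibres of [h] form the common refinement of the partitions of [phi] and [psi], on which the
    two integrals can be compared and added term by term. *)
Let s := [seq (a, b) | a <- nnsfun_values phi, b <- nnsfun_values psi].
Let h x := (phi x, psi x).
Let m t := mu (h @^-1` [set t]).

Let mh t : measurable (h @^-1` [set t]).
Proof.
rewrite (_ : _ @^-1` _ = phi @^-1` [set t.1] `&` psi @^-1` [set t.2]).
  by apply: measurableI; exact: measurable_sfunP.
by case: t => a b; apply/seteqP; split=> x /=; [case=> <- <-|case=> <- <-].
Qed.

Let us : uniq s.
Proof.
by apply: allpairs_uniq; rewrite ?nnsfun_values_uniq// => -[? ?] [? ?].
Qed.

Let hs x : h x \in s.
Proof. by apply/allpairs_f; apply/mem_nnsfun_values; exists x. Qed.

Let m_ge0 t : Fin 0 <= m t. Proof. exact: vmeas_ge0. Qed.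

Lemma sintegral_le : (forall x, phi x <= psi x) ->
  sintegral phi <= sintegral psi.
Proof.
move=> le; rewrite (sintegral_fibers (phi := phi) (r := fst) mh us)//.
rewrite (sintegral_fibers (phi := psi) (r := snd) mh us)//.
apply: ext_ler_sum => t.
(* On a nonempty fibre the label is the pair of values at some point [x], where the pointwise
   hypothesis applies. *)
have [->|/set0P[x hx]] := eqVneq (h @^-1` [set t]) set0;
  first by rewrite vmeas0 !ext_scale0.
rewrite -hx; apply: ext_leZl; [exact: fun_ge0|exact: le|exact: m_ge0].
Qed.

Lemma sintegralD chi : (forall x, chi x = phi x + psi x) ->
  sintegral chi = sintegral phi + sintegral psi.
Proof.
move=> chiE; rewrite (sintegral_fibers (phi := phi) (r := fst) mh us)//.
rewrite (sintegral_fibers (phi := psi) (r := snd) mh us)//.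
rewrite (sintegral_fibers (phi := chi) (r := fun t => t.1 + t.2) mh us)//.
rewrite -big_split/=.
apply: eq_bigr => t _.
have [->|/set0P[x hx]] := eqVneq (h @^-1` [set t]) set0;
  first by rewrite vmeas0 !ext_scale0 addr0.
by rewrite -hx ext_scaleDl//=; exact: fun_ge0.
Qed.

End joint.

Lemma sintegral_ge0 phi : Fin 0 <= sintegral phi.
Proof.
rewrite sintegralE big_seq; apply: ext_sumr_ge0 => r /nnsfun_values_ge0 r0.
by apply: ext_scale_ge0 => //; exact: vmeas_ge0.
Qed.

Lemma sintegralZ r phi psi : (forall x, psi x = r * phi x) ->
  sintegral psi = ext_scale r (sintegral phi).
Proof.
move=> psiE.
rewrite (@sintegral_fibers _ phi (nnsfun_values phi) (fun a => r * a))//.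
- by rewrite sintegralE ext_scale_sum; apply: eq_bigr => a _;
    rewrite ext_scaleA.
- exact: nnsfun_values_uniq.
- by move=> x; apply/mem_nnsfun_values; exists x.
Qed.

(** Partition by the value of [phi] and by membership in [A]; the pieces outside [A] carry the
    coefficient [0]. *)
Lemma sintegral_restrict phi psi A : measurable A ->
  (forall x, psi x = phi x * \1_A x) ->
  sintegral psi =
    \sum_(r <- nnsfun_values phi) ext_scale r (mu (phi @^-1` [set r] `&` A)).
Proof.
move=> mA psiE.
pose s := [seq (a, b) | a <- nnsfun_values phi, b <- [:: true; false]].
rewrite (@sintegral_fibers _ (fun x => (phi x, x \in A)) s
  (fun t => t.1 * t.2%:R)).
- rewrite big_allpairs; apply: eq_bigr => r _.
  rewrite big_cons big_seq1/= mulr1 mulr0 ext_0scale addr0;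
    congr (ext_scale _ (mu _)).
  apply/seteqP; split=> x /=; first by case=> -> /set_mem.
  by case=> -> /mem_set ->.
- move=> [a b]; rewrite (_ : _ @^-1` _ =
    phi @^-1` [set a] `&` (if b then A else ~` A)).
    apply: measurableI; first exact: measurable_sfunP.
    by case: b => //; exact: measurableC.
  apply/seteqP; split=> x /=.
    by case=> -> <-; split=> //; case: ifPn;
      [exact: set_mem|by rewrite notin_setE].
  by case=> ->; case: b => [/mem_set ->//|nAx]; congr (_, _); apply: memNset.
- by apply: allpairs_uniq; rewrite ?nnsfun_values_uniq// => -[? ?] [? ?].
- move=> x; apply/allpairs_f; first by apply/mem_nnsfun_values; exists x.
  by case: (x \in A).
- by move=> x; rewrite psiE indicE.
Qed.

Lemma sintegral_indic A phi : measurable A -> (forall x, phi x = \1_A x) ->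
  sintegral phi = mu A.
Proof.
move=> mA phiE.
rewrite (@sintegral_fibers _ (fun x => x \in A) [:: true; false]
  (fun b => b%:R))//.
- rewrite big_cons big_seq1/= ext_0scale ext_scale1 addr0; congr (mu _).
  by apply/seteqP; split=> x /=; [exact: set_mem|exact: mem_set].
- move=> b; rewrite (_ : _ @^-1` _ = if b then A else ~` A).
    by case: b => //; exact: measurableC.
  case: b; apply/seteqP; split=> x /=;
    [exact: set_mem|exact: mem_set| |exact: memNset].
  by move=> xA /mem_set; rewrite xA.
- by move=> x; case: (x \in A).
Qed.

(** Expand both integrals: terms with coefficient [0] vanish, and fibres of nonzero values of [phi]
    and [psi] are disjoint sets. *)
Lemma sintegral_disjoint phi psi :
  (forall A B e1 e2, measurable A -> measurable B -> A `&` B = set0 ->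
     mu A = Fin e1 -> mu B = Fin e2 -> vmeet e1 e2 = 0) ->
  (forall x, phi x = 0 \/ psi x = 0) ->
  ext_disjoint (sintegral phi) (sintegral psi).
Proof.
move=> hmu phipsi.
(* [ext_disjoint_sum] asks for positive terms at every index, also at reals outside the range of
   [chi]; the absolute value provides this without changing the sums. *)
have ge0 (chi : {nnsfun X >-> R}) (r : R) :
    Fin 0 <= ext_scale `|r| (mu (chi @^-1` [set r])).
  by apply: ext_scale_ge0 => //; exact: vmeas_ge0.
have E' (chi : {nnsfun X >-> R}) : sintegral chi =
    \sum_(r <- nnsfun_values chi) ext_scale `|r| (mu (chi @^-1` [set r])).
  rewrite sintegralE !big_seq; apply: eq_bigr => r /nnsfun_values_ge0 r0.
  by rewrite ger0_norm.
rewrite !E'; apply: ext_disjoint_sum => // [|b]; first exact: ext_sumr_ge0.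
apply: ext_disjointC; apply: ext_disjoint_sum => // a.
have [->|a0] := eqVneq a 0; first by rewrite normr0 ext_0scale;
  exact: ext_disjoint0.
apply: ext_disjointZ => //; first exact: vmeas_ge0.
apply: ext_disjointC.
have [->|b0] := eqVneq b 0.
  by rewrite normr0 ext_0scale; apply/ext_disjoint0/vmeas_ge0.
apply: ext_disjointZ => //; try exact: vmeas_ge0.
move=> e1 e2; apply: hmu; try exact: measurable_sfunP.
apply/seteqP; split=> x //= [xa xb].
by have [|] := phipsi x; rewrite ?xa ?xb => /eqP;
  [rewrite (negbTE a0)|rewrite (negbTE b0)].
Qed.

End measure_theory.

(** * The order integral *)

Section order_integral.
Context d (X : measurableType d) (R : realType) (E : vectorLatticeType R).
Variable mu : vmeasure X E.
Implicit Types (f g h : {mfun X >-> R}) (phi psi : {nnsfun X >-> R}).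
Local Notation sintegral := (simple_ointegral mu).

Definition oint (f : X -> R) := ointegral mu (fun x => (f x)%:E).

(** The supremum of this set describes the integral of a positive [f] with no reference to an
    approximating sequence. *)
Definition sintegrals_below (f : X -> R) : set (with_infty E) :=
  [set sintegral phi |
    phi in [set phi : {nnsfun X >-> R} | forall x, phi x <= f x]].

(* On the sets [c * phi <= F n], which increase to the whole space,
   [c * S(phi)] is dominated by the integrals below [F n]; then [c] tends to
   [1] by the Archimedean property. *)
Lemma sintegral_le_sup phi (F : nat -> {mfun X >-> R}) v :
  (forall n x, 0 <= F n x) -> (forall x, nondecreasing_seq (F ^~ x)) ->
  (forall x a, a < phi x -> exists n, a < F n x) ->
  (forall n, ubound (sintegrals_below (F n)) v) -> sintegral phi <= v.
Proof.
move=> F0 ndF Fphi; case: v => [e|] ub_v; last by case: (sintegral phi).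
have le_e (c : R) : 0 < c -> c < 1 -> ext_scale c (sintegral phi) <= Fin e.
  move=> c0 c1; pose B n := [set x | c * phi x <= F n x].
  have mB n : measurable (B n).
    rewrite -[B n]setTI; apply: measurable_fun_le => //.
    exact: measurable_funM.
  have ndB : nondecreasing_seq B.
    by move=> m n mn; apply/subsetPset => x /= /le_trans; apply; exact: ndF.
  have BT : \bigcup_n B n = setT.
    apply/seteqP; split=> // x _.
    have [x0|x0] := eqVneq (phi x) 0.
      by exists 0%N => //; rewrite /B/= x0 mulr0.
    have [|n /ltW h] := Fphi x (c * phi x); last by exists n.
    by rewrite gtr_pMl// lt_neqAle eq_sym x0 fun_ge0.
  have sup_phi : supremums (range (fun n => sintegral (proj_nnsfun phi (mB n))))
      (sintegral phi).
    have -> : (fun n => sintegral (proj_nnsfun phi (mB n))) = fun n =>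
        \sum_(r <- nnsfun_values phi)
          ext_scale r (mu (phi @^-1` [set r] `&` B n)).
      by apply/funext => n; exact: sintegral_restrict.
    rewrite sintegralE; apply: ext_sup_sum => r /nnsfun_values_ge0 r0.
      move=> m n mn; apply: ext_leZ => //; apply: vmeas_le.
      - by apply: measurableI => //; exact: measurable_sfunP.
      - by apply: measurableI => //; exact: measurable_sfunP.
      - by apply: setIS; exact/subsetPset/ndB.
    apply: ext_supZ => //.
    rewrite -[X in mu X]setIT -BT setI_bigcupr; apply: vmeas_cvg.
      by move=> n; apply: measurableI => //; exact: measurable_sfunP.
    by move=> m n mn; apply/subsetPset; apply: setIS; exact/subsetPset/ndB.
  have [_] := ext_supZ (ltW c0) sup_phi; apply => _ [n _ <-].
  pose psi := scale_nnsfun (proj_nnsfun phi (mB n)) (ltW c0).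
  rewrite -(@sintegralZ _ _ _ _ mu c _ psi)//; apply: (ub_v n).
  exists psi => // x; rewrite /psi/= /mindic indicE.
  have [/set_mem/=|_] := boolP (x \in B n); first by rewrite mulr1.
  by rewrite !mulr0.
(* A single admissible [c], here [1/2], already shows that the integral of [phi] is finite. *)
have h0 : 0 < 2^-1 :> R by rewrite invr_gt0.
have h1 : 2^-1 < 1 :> R by rewrite invf_lt1// ltr1n.
have [a] := ext_le_Fin (le_e _ h0 h1).
move=> /ext_scale_Fin[/eqP|[{}a Sa _] _]; first by rewrite gt_eqF.
have := sintegral_ge0 mu phi; rewrite Sa => a0.
change (a <= e); apply: varchi_mul => // c c0 c1.
by have := le_e c c0 c1; rewrite Sa.
Qed.

(** This is the independence of the approximating sequence: the supremum on the right depends on [f]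
    only. *)
Lemma is_ointegral_sup f v : is_ointegral mu (fun x => (f x)%:E) v ->
  supremums (sintegrals_below f) v.
Proof.
move=> [phi [ndphi cvgphi [ub lb]]].
have {}cvgphi x : phi n x @[n --> \oo] --> f x.
  by have /fine_cvgP[] := cvgphi x.
split.
  move=> _ [psi psif <-]; apply: (sintegral_le_sup (F := phi)) => //.
  - move=> x a ax; have /cvgr_gt/(_ a) := cvgphi x.
    by move=> /(_ (lt_le_trans ax (psif x)))[n _ /(_ n (leqnn n))]; exists n.
  - move=> n _ [chi chin <-]; apply: (@le_trans _ _ (sintegral (phi n))).
      exact: sintegral_le.
    by apply: ub; exists n.
move=> y h; apply: lb => _ [n _ <-]; apply: h; exists (phi n) => // x.
rewrite -(cvg_lim _ (cvgphi x))//; apply: nondecreasing_cvgn_le => //.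
by apply/cvg_ex; exists (f x).
Qed.

Lemma nnsfun_approximation f : (forall x, 0 <= f x) ->
  exists phi : nat -> {nnsfun X >-> R},
    (forall x, nondecreasing_seq (fun n => phi n x)) /\
    (forall x, phi n x @[n --> \oo] --> f x).
Proof.
move=> f0; have mf : measurable_fun setT (EFin \o f) by exact/measurable_EFinP.
exists (nnsfun_approx measurableT mf); split=> x.
  by move=> m n mn; have /lefP := nd_nnsfun_approx measurableT mf mn.
have /fine_cvgP[] := @cvg_nnsfun_approx _ _ _ _ measurableT _ mf
  (fun x _ => f0 x) x I.
by [].
Qed.

Hypothesis hE : sigma_dedekind_complete [set: E].

(** Completeness of [E] gives the integrals of an approximating sequence a supremum, so [xget]
    returns a genuine integral and not its default. *)
Lemma oint_sup f : (forall x, 0 <= f x) ->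
  supremums (sintegrals_below f) (oint f).
Proof.
move=> f0; apply: is_ointegral_sup; rewrite /oint /ointegral.
have [phi [ndphi cvgphi]] := nnsfun_approximation f0.
have [v supv] := ext_sup_exists (fun n => sintegral (phi n)) hE.
apply: (@xgetPex _ _ (is_ointegral mu (fun x => (f x)%:E))); exists v, phi.
by split=> // x; apply: cvg_EFin; [exact: nearW|exact: cvgphi].
Qed.

Lemma oint_unique f v : (forall x, 0 <= f x) ->
  supremums (sintegrals_below f) v -> oint f = v.
Proof. by move=> f0; apply: ext_sup_unique; exact: oint_sup. Qed.

Lemma oint_nnsfun phi f : (forall x, f x = phi x) -> oint f = sintegral phi.
Proof.
move=> fphi; apply: oint_unique => [x|]; first by rewrite fphi fun_ge0.
split=> [_ [psi psif <-]|y h]; first by apply: sintegral_le => x; rewrite -fphi.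
by apply: h; exists phi => // x; rewrite fphi.
Qed.

Lemma oint_indic f A : measurable A -> (forall x, f x = \1_A x) ->
  oint f = mu A.
Proof.
move=> mA fA; rewrite (@oint_nnsfun (indic_nnsfun R mA))//.
exact: sintegral_indic.
Qed.

Lemma oint_ge0 f : (forall x, 0 <= f x) -> Fin 0 <= oint f.
Proof.
move=> f0; have [ub _] := oint_sup f0.
apply: le_trans (sintegral_ge0 mu (cst_nnsfun _ (0%:nng))) _.
by apply: ub; exists (cst_nnsfun _ (0%:nng)) => //.
Qed.

Lemma le_oint f g : (forall x, 0 <= f x) -> (forall x, f x <= g x) ->
  oint f <= oint g.
Proof.
move=> f0 fg; have g0 x := le_trans (f0 x) (fg x).
have [_ lb] := oint_sup f0; have [ub _] := oint_sup g0.
apply: lb => _ [phi phif <-]; apply: ub; exists phi => // x.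
exact: le_trans (phif x) (fg x).
Qed.

Lemma oint_monotone_convergence (F : nat -> {mfun X >-> R}) f :
  (forall n x, 0 <= F n x) -> (forall x, nondecreasing_seq (F ^~ x)) ->
  (forall x, F n x @[n --> \oo] --> f x) ->
  supremums (range (fun n => oint (F n))) (oint f).
Proof.
move=> F0 ndF cvgF.
have Ff n x : F n x <= f x.
  rewrite -(cvg_lim _ (cvgF x))//; apply: nondecreasing_cvgn_le => //.
  by apply/cvg_ex; exists (f x).
have f0 x : 0 <= f x by apply: le_trans (F0 0%N x) (Ff _ _).
split=> [_ [n _ <-]|v h]; first exact: le_oint.
have [_] := oint_sup f0; apply => _ [phi phif <-].
apply: (sintegral_le_sup (F := F)) => //.
  move=> x a ax; have /cvgr_gt/(_ a) := cvgF x.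
  by move=> /(_ (lt_le_trans ax (phif x)))[n _ /(_ n (leqnn n))]; exists n.
move=> n _ [chi chin <-]; have [ub _] := oint_sup (F0 n).
apply: (@le_trans _ _ (oint (F n))); first by apply: ub; exists chi.
by apply: h; exists n.
Qed.

Lemma ointD f g h : (forall x, 0 <= f x) -> (forall x, 0 <= g x) ->
  (forall x, h x = f x + g x) -> oint h = oint f + oint g.
Proof.
move=> f0 g0 hfg.
have [phi [ndphi cvgphi]] := nnsfun_approximation f0.
have [psi [ndpsi cvgpsi]] := nnsfun_approximation g0.
have phi0 n x : 0 <= phi n x by exact: fun_ge0.
have psi0 n x : 0 <= psi n x by exact: fun_ge0.
apply: (@ext_sup_unique _ _
  (range (fun n => oint (phi n) + oint (psi n)))); last first.
  apply: ext_supD.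
  - by move=> m n mn; apply: le_oint => // x; exact: ndphi.
  - by move=> m n mn; apply: le_oint => // x; exact: ndpsi.
  - exact: oint_monotone_convergence.
  - exact: oint_monotone_convergence.
have -> : (fun n => oint (phi n) + oint (psi n)) =
    fun n => oint (add_nnsfun (phi n) (psi n)).
  apply/funext => n; rewrite (@oint_nnsfun (phi n))// (@oint_nnsfun (psi n))//.
  by rewrite (@oint_nnsfun (add_nnsfun (phi n) (psi n)))//;
    exact/esym/sintegralD.
apply: oint_monotone_convergence => x //.
- by move=> m n mn; apply: lerD; [exact: ndphi|exact: ndpsi].
- by rewrite hfg; apply: cvgD; [exact: cvgphi|exact: cvgpsi].
Qed.

Lemma ointZ (a : R) f g : 0 <= a -> (forall x, 0 <= f x) ->
  (forall x, g x = a * f x) -> oint g = ext_scale a (oint f).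
Proof.
move=> a0 f0 gaf.
have [phi [ndphi cvgphi]] := nnsfun_approximation f0.
have phi0 n x : 0 <= phi n x by exact: fun_ge0.
apply: (@ext_sup_unique _ _
  (range (fun n => ext_scale a (oint (phi n))))); last first.
  by apply: ext_supZ => //; exact: oint_monotone_convergence.
have -> : (fun n => ext_scale a (oint (phi n))) =
    fun n => oint (scale_nnsfun (phi n) a0).
  apply/funext => n; rewrite (@oint_nnsfun (phi n))//.
  rewrite (@oint_nnsfun (scale_nnsfun (phi n) a0))//.
  exact/esym/sintegralZ.
apply: oint_monotone_convergence => x //.
- by move=> m n mn; apply: ler_wpM2l => //; exact: ndphi.
- by rewrite gaf; apply: cvgMr; exact: cvgphi.
Qed.

Lemma oint_eq0 f : (forall x, 0 <= f x) ->
  oint f = 0 <-> valmost_everywhere mu (fun x => f x = 0).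
Proof.
move=> f0; split=> [If0|[A [mA A0 fA]]].
  (* The sets [B n] exhaust the points where [f] is positive, and each is null because
     [mu (B n) / (n+1)] is at most the integral of [f]. *)
  pose B n := [set x | n.+1%:R^-1 <= f x].
  have mB n : measurable (B n).
    by rewrite -[B n]setTI; apply: measurable_fun_le.
  have : vnull mu (\bigcup_n B n).
    apply: vnull_bigcup => n; exists (B n); split=> //.
    apply/le_anti/andP; split; last exact: vmeas_ge0.
    have n0 : 0 <= n.+1%:R^-1 :> R by rewrite invr_ge0.
    pose phi := scale_nnsfun (indic_nnsfun R (mB n)) n0.
    have : oint phi <= oint f.
      apply: le_oint => x; first exact: fun_ge0.
      rewrite /phi/= /mindic indicE.
      by have [/set_mem|_] := boolP (x \in B n); rewrite ?mulr1 ?mulr0.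
    rewrite (@ointZ _ (indic_nnsfun R (mB n)) phi n0)//.
    rewrite (@oint_indic _ (B n))// If0.
    move=> /(@ext_leZ _ _ n.+1%:R _ _ (ler0n _ _)).
    by rewrite ext_scaleA mulfV ?pnatr_eq0// ext_scale1 ext_scale0.
  move=> [A [mA A0 hA]]; exists A; split=> // x /= /eqP fx; apply: hA.
  have /ltr_add_invr[n] : 0 < f x by rewrite lt_neqAle eq_sym fx f0.
  by rewrite add0r => /ltW; exists n.
apply: oint_unique => //.
(* For the converse, every fibre of a nonzero value of a simple function below [f] lies in the null
   set [A]. *)
have S0 phi : (forall x, phi x <= f x) -> sintegral phi = 0.
  move=> phif; rewrite sintegralE big1// => r _.
  have [->|r0] := eqVneq r 0; first by rewrite ext_0scale.
  suff -> : mu (phi @^-1` [set r]) = 0 by rewrite ext_scale0.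
  apply/le_anti/andP; split; last exact: vmeas_ge0.
  have <- := A0; apply: vmeas_le => // x /= phir; apply: fA => /= fx0.
  move/eqP: r0; apply; rewrite -phir; apply/le_anti.
  by rewrite fun_ge0 andbT -fx0 phif.
split=> [_ [phi phif <-]|y h]; first by rewrite S0.
have phif x : cst_nnsfun X (0%:nng : {nonneg R}) x <= f x by exact: f0.
by rewrite -(S0 _ phif); apply: h; exists (cst_nnsfun X (0%:nng)).
Qed.

End order_integral.

(** * Linearity on integrable functions *)

Section integral_on_L1.
Context d (X : measurableType d) (R : realType) (E : vectorLatticeType R).
Hypothesis hE : sigma_dedekind_complete [set: E].
Variable mu : vmeasure X E.
Implicit Types (f g h : {mfun X >-> R}).
Local Notation oint := (oint mu).

(** Writing the absolute value as a join keeps it within [{mfun X >-> R}], where the lemmas on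
    [oint] apply. *)
Lemma calL1E f : calL1 mu f <-> ext_finite (oint (vjoin f (- f))).
Proof.
rewrite /calL1 /= /oint; suff -> : (fun x => `|f x|%:E) = fun x =>
  (vjoin f (- f) x)%:E by [].
by apply/funext => x; rewrite -maxrN.
Qed.

Lemma calL1_le f h : (forall x, `|f x| <= h x) -> ext_finite (oint h) ->
  calL1 mu f.
Proof.
move=> fh [e he]; apply/calL1E.
have : oint (vjoin f (- f)) <= oint h.
  apply: le_oint => // x; last by have := fh x; rewrite -maxrN.
  by have := normr_ge0 (f x); rewrite -maxrN.
by rewrite he => /ext_le_Fin[a -> _]; exists a.
Qed.

Lemma calL1_Fin f h : calL1 mu f -> (forall x, 0 <= h x) ->
  (forall x, h x <= `|f x|) -> exists e, oint h = Fin e.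
Proof.
move=> /calL1E[e fe] h0 hf.
have : oint h <= oint (vjoin f (- f)).
  by apply: le_oint => // x; have := hf x; rewrite -maxrN.
by rewrite fe => /ext_le_Fin[a -> _]; exists a.
Qed.

Lemma calL1_dominated f h : calL1 mu h -> (forall x, `|f x| <= `|h x|) ->
  calL1 mu f.
Proof.
move=> /calL1E hL fh; apply: calL1_le hL => x.
by rewrite (le_trans (fh x))// -maxrN.
Qed.

Lemma calL1_ge0 f : (forall x, 0 <= f x) -> calL1 mu f <-> ext_finite (oint f).
Proof.
move=> f0; split=> [fL|]; first by apply: calL1_Fin fL f0 _ => x;
  exact: ler_norm.
by apply: calL1_le => x; rewrite ger0_norm.
Qed.

Lemma mfun_pos_ge0 f x : 0 <= vjoin f 0 x.
Proof. by change (0 <= Num.max (f x) 0); rewrite le_max lexx orbT. Qed.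

Lemma mfun_pos_sub_neg f x : f x = vjoin f 0 x - vjoin (- f) 0 x.
Proof.
change (f x = Num.max (f x) 0 - Num.max (- f x) 0).
have [fx|/ltW fx] := lerP (f x) 0.
  by rewrite max_l ?oppr_ge0// sub0r opprK.
by rewrite max_r ?oppr_le0// subr0.
Qed.

Lemma mfun_abs_ge0 f x : 0 <= vjoin f (- f) x.
Proof. by have := normr_ge0 (f x); rewrite -maxrN. Qed.

Lemma calL1D f g : calL1 mu f -> calL1 mu g -> calL1 mu (f + g).
Proof.
move=> /calL1E[a fa] /calL1E[b gb].
apply: (@calL1_le _ (vjoin f (- f) + vjoin g (- g))).
  move=> x; apply: le_trans (ler_normD _ _) _.
  by rewrite -(maxrN (f x)) -(maxrN (g x)).
rewrite (@ointD _ _ _ _ _ hE (vjoin f (- f)) (vjoin g (- g)))//.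
- by rewrite fa gb; exists (a + b).
- exact: mfun_abs_ge0.
- exact: mfun_abs_ge0.
Qed.

Lemma calL1Z (a : R) f : calL1 mu f -> calL1 mu (a *: f).
Proof.
move=> /calL1E[b fb]; apply: (@calL1_le _ (`|a| *: vjoin f (- f))).
  by move=> x; rewrite normrM -(maxrN (f x)).
rewrite (@ointZ _ _ _ _ _ hE `|a| (vjoin f (- f)))//.
- by rewrite fb; exists (`|a| *: b).
- exact: mfun_abs_ge0.
Qed.

Lemma calL1_abs f : calL1 mu f -> calL1 mu (vjoin f (- f)).
Proof.
by move=> fL; apply: calL1_dominated fL _ => x;
  rewrite -[X in _ <= X]normr_id -(maxrN (f x)).
Qed.

Lemma vector_sublattice_calL1 : vector_sublattice (calL1 mu).
Proof.
have dom f g h : calL1 mu f -> calL1 mu g ->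
    (forall x, `|h x| <= `|f x| + `|g x|) -> calL1 mu h.
  move=> fL gL hfg.
  apply: (calL1_dominated (calL1D (calL1_abs fL) (calL1_abs gL))) => x.
  rewrite (le_trans (hfg x))// (le_trans _ (ler_norm _))//.
  by rewrite -(maxrN (f x)) -(maxrN (g x)).
split.
- apply/calL1_ge0 => //; exists 0.
  by apply/oint_eq0 => //; exact: vae_true.
- by move=> a f g fL gL; apply: calL1D => //; exact: calL1Z.
- move=> f g fL gL; apply: dom fL gL _ => x.
  have : vjoin f g x = f x \/ vjoin f g x = g x.
    by change (Num.max (f x) (g x) = f x \/ Num.max (f x) (g x) = g x);
      case: leP; [right|left].
  by case=> ->; rewrite ?lerDl ?lerDr.
- move=> f g fL gL; apply: dom fL gL _ => x.
  have : vmeet f g x = f x \/ vmeet f g x = g x.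
    by change (Num.min (f x) (g x) = f x \/ Num.min (f x) (g x) = g x);
      case: leP; [left|right].
  by case=> ->; rewrite ?lerDl ?lerDr.
Qed.

Lemma calL1_pos_neg f : calL1 mu f -> exists a b,
  [/\ oint (vjoin f 0) = Fin a, oint (vjoin (- f) 0) = Fin b
    & Iint mu f = a - b].
Proof.
move=> fL.
have p0 := mfun_pos_ge0 f; have n0 := mfun_pos_ge0 (- f).
have [|a fa] := calL1_Fin fL p0.
  by move=> x; change (Num.max (f x) 0 <= `|f x|); rewrite ge_max ler_norm/=.
have [|b fb] := calL1_Fin fL n0.
  by move=> x; change (Num.max (- f x) 0 <= `|f x|);
    rewrite ge_max -normrN ler_norm/=.
exists a, b; split=> //.
change (ext_fine (oint (vjoin f 0)) - ext_fine (oint (vjoin (- f) 0)) = a - b).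
by rewrite fa fb.
Qed.

(** Any splitting into positive integrable functions computes the integral: [f^+ + h = f^- + g]
    pointwise, so additivity on positive functions gives the identity after rearranging. *)
Lemma Iint_sub f g h a b : (forall x, 0 <= g x) -> (forall x, 0 <= h x) ->
  (forall x, f x = g x - h x) -> oint g = Fin a -> oint h = Fin b ->
  Iint mu f = a - b.
Proof.
move=> g0 h0 fgh ga hb.
have fL : calL1 mu f.
  apply: (@calL1_le _ (g + h)).
    by move=> x; rewrite fgh; apply: le_trans (ler_normB _ _) _;
      rewrite !ger0_norm.
  by rewrite (@ointD _ _ _ _ _ hE g h)// ga hb; exists (a + b).
have [c [e [fc fe ->]]] := calL1_pos_neg fL.
have p0 := mfun_pos_ge0 f; have n0 := mfun_pos_ge0 (- f).
have := @ointD _ _ _ _ mu hE (vjoin f 0) h (vjoin f 0 + h) p0 h0 (fun=> erefl).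
rewrite (@ointD _ _ _ _ mu hE (vjoin (- f) 0) g)//; last first.
  move=> x; change (Num.max (f x) 0 + h x = Num.max (- f x) 0 + g x).
  have := mfun_pos_sub_neg f x; rewrite {1}fgh => /eqP.
  by rewrite subr_eq addrAC eq_sym subr_eq [RHS]addrC => /eqP.
rewrite fc fe ga hb => -[cb]; apply/eqP.
by rewrite subr_eq addrAC eq_sym subr_eq -cb addrC.
Qed.

Lemma Iint_ge0E f a : (forall x, 0 <= f x) -> oint f = Fin a -> Iint mu f = a.
Proof.
move=> f0 fa; rewrite (@Iint_sub f f 0 a 0)// ?subr0//.
- by move=> x; change (f x = f x - 0); rewrite subr0.
- by apply/oint_eq0 => //; exact: vae_true.
Qed.

Lemma Iint_ge0 f : calL1 mu f -> (forall x, 0 <= f x) -> 0 <= Iint mu f.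
Proof.
move=> fL f0; have [e fe] := (calL1_ge0 f0).1 fL; rewrite (Iint_ge0E f0 fe).
by have := oint_ge0 mu hE f0; rewrite fe.
Qed.

Lemma Iint_linear (a : R) f g : calL1 mu f -> calL1 mu g ->
  Iint mu (a *: f + g) = a *: Iint mu f + Iint mu g.
Proof.
move=> fL gL.
have [fp [fn [Hfp Hfn ->]]] := calL1_pos_neg fL.
have [gp [gn [Hgp Hgn ->]]] := calL1_pos_neg gL.
have p0 := mfun_pos_ge0; have split := mfun_pos_sub_neg.
have comb (b : R) (h k : {mfun X >-> R}) c e : 0 <= b -> (forall x, 0 <= h x) ->
  (forall x, 0 <= k x) ->
    oint h = Fin c -> oint k = Fin e -> oint (b *: h + k) = Fin (b *: c + e).
  move=> b0 h0 k0 hc ke; have bh0 x : 0 <= (b *: h) x by change (0 <= b * h x);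
    exact: mulr_ge0.
  rewrite (@ointD _ _ _ _ mu hE (b *: h) k)//.
  by rewrite (@ointZ _ _ _ _ mu hE b h)// hc ke.
have combp (b : R) (h k : {mfun X >-> R}) x : 0 <= b -> (forall x, 0 <= h x) ->
  (forall x, 0 <= k x) ->
    0 <= (b *: h + k) x.
  by move=> b0 h0 k0; change (0 <= b * h x + k x); rewrite addr_ge0 ?mulr_ge0.
have [a0|a0] := lerP 0 a.
  rewrite (@Iint_sub _ (a *: vjoin f 0 + vjoin g 0)
    (a *: vjoin (- f) 0 + vjoin (- g) 0) (a *: fp + gp) (a *: fn + gn)).
  - by rewrite scalerBr opprD addrACA.
  - by move=> x; exact: combp.
  - by move=> x; exact: combp.
  - move=> x; change (a * f x + g x = a * vjoin f 0 x + vjoin g 0 x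
      - (a * vjoin (- f) 0 x + vjoin (- g) 0 x)).
    by rewrite {1}(split f) {1}(split g) mulrBr opprD addrACA.
  - exact: comb.
  - exact: comb.
(* For negative [a] the positive and negative parts of [f] exchange roles. *)
have Na0 : 0 <= - a by rewrite oppr_ge0 ltW.
rewrite (@Iint_sub _ (- a *: vjoin (- f) 0 + vjoin g 0)
  (- a *: vjoin f 0 + vjoin (- g) 0) (- a *: fn + gp) (- a *: fp + gn)).
- by rewrite scalerBr !scaleNr opprD opprK addrACA [in LHS](addrC (- _)).
- by move=> x; exact: combp.
- by move=> x; exact: combp.
- move=> x; change (a * f x + g x = - a * vjoin (- f) 0 x + vjoin g 0 x
    - (- a * vjoin f 0 x + vjoin (- g) 0 x)).
  by rewrite {1}(split f) {1}(split g); ring.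
- exact: comb.
- exact: comb.
Qed.

Lemma calN_calL1 f : calN mu f -> calL1 mu f /\ Iint mu f = 0.
Proof.
move=> fN.
have N0 h : (forall x, 0 <= h x) -> (forall x, f x = 0 -> h x = 0) ->
  oint h = Fin 0.
  by move=> h0 fh; apply/oint_eq0 => //; apply: vae_imp fN.
split.
  apply/calL1E; exists 0; apply: N0; first exact: mfun_abs_ge0.
  by move=> x fx; change (Num.max (f x) (- f x) = 0); rewrite fx oppr0 maxxx.
rewrite (@Iint_sub _ (vjoin f 0) (vjoin (- f) 0) 0 0) ?subr0//.
- exact: mfun_pos_ge0.
- exact: mfun_pos_ge0.
- exact: mfun_pos_sub_neg.
- apply: N0 => x; first exact: mfun_pos_ge0.
  by move=> fx; change (Num.max (f x) 0 = 0); rewrite fx maxxx.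
- apply: N0 => x; first exact: mfun_pos_ge0.
  by move=> fx; change (Num.max (- f x) 0 = 0); rewrite fx oppr0 maxxx.
Qed.

End integral_on_L1.
(** * Lattice homomorphisms *)

Section multiplicative_measure.
Context d (X : measurableType d) (R : realType) (E : vectorLatticeType R).
Hypothesis hE : sigma_dedekind_complete [set: E].
Variable mu : vmeasure X E.
Implicit Types (f g h : {mfun X >-> R}).

Definition vmeas_meet := forall (D1 D2 : set X) (e1 e2 : E),
  measurable D1 -> measurable D2 ->
  mu D1 = Fin e1 -> mu D2 = Fin e2 -> mu (D1 `&` D2) = Fin (vmeet e1 e2).

Definition vmeas_join := forall (D1 D2 : set X) (e1 e2 : E),
  measurable D1 -> measurable D2 ->
  mu D1 = Fin e1 -> mu D2 = Fin e2 -> mu (D1 `|` D2) = Fin (vjoin e1 e2).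

(** Split the union into [D1] and the difference of [D2] and [D1]; that difference and the
    intersection make up [D2]. *)
Lemma vmeas_setUI D1 D2 : measurable D1 -> measurable D2 ->
  mu (D1 `|` D2) + mu (D1 `&` D2) = mu D1 + mu D2.
Proof.
move=> m1 m2; have mI := measurableI _ _ m1 m2; have mD := measurableD m2 m1.
have -> : D1 `|` D2 = D1 `|` (D2 `\` D1).
  apply/seteqP; split=> x; last by case=> [|[]]; [left|right].
  by have [D1x _|nD1x [//|D2x]] := pselect (D1 x); [left|right].
rewrite vmeasU ?setDIK// -addrA; congr (_ + _).
rewrite addrC -vmeasU//.
  by rewrite setIC setUIDK.
by apply/seteqP; split=> x // [[? _] []].
Qed.

(** For sets of finite measure the sum formula forces both terms on its left to be finite, so either
    one determines the other by subtraction in [E]. *)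
Lemma vmeas_meet_join : vmeas_meet <-> vmeas_join.
Proof.
have fin D1 D2 e1 e2 : measurable D1 -> measurable D2 ->
    mu D1 = Fin e1 -> mu D2 = Fin e2 -> exists2 m,
    mu (D1 `&` D2) = Fin m & mu (D1 `|` D2) = Fin (e1 + e2 - m).
  move=> m1 m2 D1e D2e.
  have /esym := vmeas_setUI m1 m2; rewrite D1e D2e => /esym.
  move=> /ext_add_Fin[u [m [-> -> ->]]].
  by exists m => //; rewrite addrK.
split=> H D1 D2 e1 e2 m1 m2 D1e D2e;
  have [m Im Um] := fin _ _ _ _ m1 m2 D1e D2e; have := H _ _ _ _ m1 m2 D1e D2e.
  by rewrite Im Um vjoinE => -[->].
rewrite Im Um vjoinE => -[] /addrI/oppr_inj ->.
by [].
Qed.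

(** The indicator of an intersection is the meet of the indicators. The domain [A] is left general
    to cover both [calL1 mu] and the bounded functions. *)
Lemma vector_lattice_hom_meet (A : set {mfun X >-> R}) :
  (forall D (mD : measurable D), ext_finite (mu D) -> A (indic_mfun D mD)) ->
  vector_lattice_hom A (Iint mu) -> vmeas_meet.
Proof.
move=> indA [_ _ _ TI] D1 D2 e1 e2 m1 m2 D1e D2e.
have indE D (mD : measurable D) e : mu D = Fin e ->
  Iint mu (indic_mfun D mD) = e.
  by move=> De; apply: (Iint_ge0E hE) => //; rewrite -De; apply: oint_indic.
have A1 := indA _ m1 (ex_intro _ _ D1e);
  have A2 := indA _ m2 (ex_intro _ _ D2e).
have := TI _ _ A1 A2; rewrite (indE _ m1 e1)// (indE _ m2 e2)// => <-.
have mI := measurableI _ _ m1 m2.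
have [e Ie] : exists e, mu (D1 `&` D2) = Fin e.
  have := vmeas_le mu mI m1 (@subIsetl _ _ _); rewrite D1e.
  by move=> /ext_le_Fin[e -> _]; exists e.
rewrite Ie -(indE _ mI e)//; congr (Fin (Iint mu _)); apply/mfuneqP => x.
change (\1_(D1 `&` D2) x = Num.min (\1_D1 x) (\1_D2 x) :> R).
rewrite !indicE in_setI; case: (x \in D1); case: (x \in D2);
  rewrite /= ?minxx//.
  by rewrite min_r.
by rewrite min_l.
Qed.

Lemma calL1_indic D (mD : measurable D) :
  ext_finite (mu D) -> calL1 mu (indic_mfun D mD).
Proof.
move=> Dfin; apply/(calL1_ge0 hE) => //.
by rewrite (oint_indic mu hE mD).
Qed.

Lemma bounded_calL1 : ext_finite (mu setT) -> bounded_mfun X R `<=` calL1 mu.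
Proof.
move=> muT f [M fM].
have M0 : 0 <= `|M| by [].
apply: (@calL1_le _ _ _ _ hE _ _ (`|M| *: indic_mfun setT measurableT)).
  move=> x; change (`|f x| <= `|M| * \1_setT x).
  by rewrite indicE in_setT mulr1 (le_trans (fM x))// ler_norm.
rewrite (@ointZ _ _ _ _ mu hE `|M| (indic_mfun setT measurableT))//.
rewrite (oint_indic mu hE measurableT)//; case: muT => e ->.
by exists (`|M| *: e).
Qed.

Lemma bounded_indic D (mD : measurable D) : bounded_mfun X R (indic_mfun D mD).
Proof.
exists 1 => x; change (`|\1_D x : R| <= 1).
by rewrite indicE; case: (_ \in _); rewrite ?normr1 ?normr0.
Qed.

Lemma vector_sublattice_bounded : vector_sublattice (bounded_mfun X R).
Proof.
split.
- by exists 0 => x; change (`|0 : R| <= 0); rewrite normr0.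
- move=> a f g [M fM] [N gN]; exists (`|a| * M + N) => x.
  apply: le_trans (ler_normD _ _) _; apply: lerD; last exact: gN.
  by change (`|a * f x| <= `|a| * M); rewrite normrM ler_wpM2l.
- move=> f g [M fM] [N gN]; exists (Num.max M N) => x.
  change (`|Num.max (f x) (g x)| <= Num.max M N).
  by rewrite le_max; case: (leP (f x) (g x)) => _; rewrite ?fM ?gN ?orbT.
- move=> f g [M fM] [N gN]; exists (Num.max M N) => x.
  change (`|Num.min (f x) (g x)| <= Num.max M N).
  by rewrite le_max; case: (leP (f x) (g x)) => _; rewrite ?fM ?gN ?orbT.
Qed.

(** It suffices to preserve disjointness. Simple functions increasing to disjoint [f] and [g] vanish
    where their limits do, so they are disjoint as well. *)
Lemma vmeas_meet_hom : vmeas_meet -> vector_lattice_hom (calL1 mu) (Iint mu).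
Proof.
move=> hmu; apply: vector_lattice_hom_disjoint.
- exact: Iint_linear.
- exact: vector_sublattice_calL1.
move=> f g fL gL fg0.
have fgx x : Num.min (f x) (g x) = 0.
  by have := congr1 (fun h : {mfun X >-> R} => h x) fg0.
have f0 x : 0 <= f x by rewrite -(fgx x) ge_min lexx.
have g0 x : 0 <= g x by rewrite -(fgx x) ge_min lexx orbT.
have [a fa] := (calL1_ge0 hE mu f0).1 fL.
have [b gb] := (calL1_ge0 hE mu g0).1 gL.
rewrite (Iint_ge0E hE f0 fa) (Iint_ge0E hE g0 gb).
have [phi [ndphi cvgphi]] := nnsfun_approximation f0.
have [psi [ndpsi cvgpsi]] := nnsfun_approximation g0.
have approx0 (u : nat -> {nnsfun X >-> R}) h n x :
    (forall x, nondecreasing_seq (fun n => u n x)) ->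
    (forall x, u n x @[n --> \oo] --> h x) -> h x = 0 -> u n x = 0.
  move=> ndu cvgu hx; apply/le_anti; rewrite fun_ge0 andbT -hx.
  rewrite -(cvg_lim _ (cvgu x))//; apply: nondecreasing_cvgn_le => //.
  by apply/cvg_ex; exists (h x).
have supphi : supremums (range (fun n => oint mu (phi n))) (oint mu f).
  by apply: oint_monotone_convergence => // n x; exact: fun_ge0.
have suppsi : supremums (range (fun n => oint mu (psi n))) (oint mu g).
  by apply: oint_monotone_convergence => // n x; exact: fun_ge0.
suff : ext_disjoint (oint mu f) (oint mu g) by apply.
have ge0 (u : nat -> {nnsfun X >-> R}) n : Fin 0 <= oint mu (u n).
  by apply: oint_ge0 => // x; exact: fun_ge0.
(* The supremum is taken in one argument at a time, first along [psi], then along [phi]. *)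
apply: (@ext_disjoint_sup _ _ (fun n => oint mu (psi n))) => //.
  exact: oint_ge0.
move=> n; apply: ext_disjointC.
apply: (@ext_disjoint_sup _ _ (fun n => oint mu (phi n))) => // m.
apply: ext_disjointC; rewrite !(@oint_nnsfun _ _ _ _ mu hE _ _ (fun=> erefl)).
apply: sintegral_disjoint => [A B e1 e2 mA mB AB0 Ae Be|x].
  (* For disjoint sets the meet of the measures is the measure of the empty set. *)
  by have := hmu _ _ _ _ mA mB Ae Be; rewrite AB0 vmeas0 => -[].
have [fx|fx] := eqVneq (f x) 0; first by left; exact: approx0 cvgphi fx.
right; apply: approx0 cvgpsi _ => //.
have := fgx x; case: leP => // _ /eqP; by rewrite (negbTE fx).
Qed.

End multiplicative_measure.

(** * Injective homomorphisms and order continuity *)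

Lemma sup_in_unique disp (T : porderType disp) (A S : set T) s t :
  sup_in A S s -> sup_in A S t -> s = t.
Proof.
by move=> [As us ls] [At ut lt]; apply/le_anti; rewrite ls// lt.
Qed.

Lemma directed_nat : directed (fun m n : nat => (m <= n)%N).
Proof.
split; [by exact: inhabits 0%N|by []|by move=> i j k; exact: leq_trans|].
by move=> i j; exists (maxn i j); rewrite ?leq_maxl ?leq_maxr.
Qed.

Section injective_homs.
Context {R : realType} {V W : vectorLatticeType R}.
Variables (A : set V) (T : V -> W).
Hypothesis homT : vector_lattice_hom A T.
Implicit Types x y : V.

Lemma vhom0 : T 0 = 0.
Proof.
have [[A0 _ _ _] linT _ _] := homT.
by have := linT (-1) _ _ A0 A0; rewrite scaler0 addr0 scaleN1r addNr.
Qed.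

Lemma vhom_le x y : A x -> A y -> x <= y -> T x <= T y.
Proof.
move=> Ax Ay xy; have [_ _ TU _] := homT.
by have := TU _ _ Ay Ax; rewrite vjoin_l// => ->; exact: vleUr.
Qed.

Hypothesis injT : set_inj A T.

(** The elements [vjoin y x] and [y] have the same image, so injectivity identifies them. *)
Lemma vhom_le_reflect x y : A x -> A y -> T x <= T y -> x <= y.
Proof.
move=> Ax Ay Txy; have [[_ _ AU _] _ TU _] := homT.
have <- : vjoin y x = y; last exact: vleUr.
apply: injT; rewrite ?inE//; first exact: AU.
by rewrite TU// vjoin_l.
Qed.

(** The continuity hypothesis concerns sequences decreasing to [0]; it is applied to [s - x n]. *)
Lemma vhom_sup_seq (x : nat -> V) s : sigma_order_continuous A T ->
  nondecreasing_seq x -> range x `<=` A -> sup_in A (range x) s ->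
  sup_in setT (range (T \o x)) (T s).
Proof.
move=> scT ndx xA [As us ls]; have [subA linT _ _] := homT.
have Ax n : A (x n) by apply: xA; exists n.
have [|_ _ [_ _ inf0]] := scT (fun n => s - x n).
  split.
  - split=> [|i j ij]; first exact: directed_nat.
    by rewrite vleD2l vleN2; exact: ndx.
  - by move=> _ [n _ <-]; exact: vector_sublatticeB.
  split; first by case: subA.
    by move=> _ [n _ <-]; rewrite vsub_ge0; apply: us; exists n.
  move=> t At tl; rewrite -(vleD2l s) addr0 -vleBrDr.
  apply: ls => [|_ [n _ <-]]; first exact: vector_sublatticeB.
  by rewrite vleBrDr addrC -vleBrDr; apply: tl; exists n.
split=> // [_ [n _ <-]|t _ ut]; first by apply: vhom_le => //; apply: us;
  exists n.
rewrite -[leRHS]add0r -vleBlDr; apply: inf0 => // _ [n _ <-] /=.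
by rewrite (vhomB linT)// vleD2l vleN2; apply: ut; exists n.
Qed.

Hypothesis dcA : sigma_dedekind_complete A.
Hypothesis scT : sigma_order_continuous A T.
Hypothesis mcW : monotone_complete [set: W].
Hypothesis cspW : countable_sup_property [set: W].

(* The supremum of [T \o x] in [W] is reached along a sequence of indices,
   which may be taken increasing; the supremum [s] of [x] along it dominates
   all of [x] because [T s] dominates [T \o x]. *)
Lemma net_sup (I : Type) (leI : I -> I -> Prop) (x : I -> V) u :
  increasing_net leI x -> range x `<=` A -> (forall i, 0 <= x i) ->
  A u -> ubound (range x) u ->
  exists (l : nat -> I) s, [/\ sup_in A (range x) s, sup_in A (range (x \o l)) s
    & sup_in setT (range (T \o x)) (T s)].
Proof.
move=> [dirI ndx] xA x0 Au ux; have [subA linT _ _] := homT.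
have Ax i : A (x i) by apply: xA; exists i.
have A0 : A 0 by case: subA.
have netTx : increasing_net leI (T \o x).
  by split=> // i j ij; apply: vhom_le => //; exact: ndx.
have [||e supe] := mcW netTx; first by [].
  by exists (T u) => // _ [i _ <-]; apply: vhom_le => //; apply: ux; exists i.
have [_ ue le] := supe.
have Tx0 i : 0 <= T (x i) by rewrite -vhom0; exact: vhom_le.
have [i0] := directed_inhabited dirI.
have [||k [_ uk lk]] := cspW Tx0 _ (And3 netTx _ supe); [|by []|].
  by apply: le_trans (Tx0 i0) _; apply: ue; exists i0.
have /choice[c cP] (ij : I * I) : exists m, leI ij.1 m /\ leI ij.2 m.
  by have [m im jm] := directed_ub dirI ij.1 ij.2; exists m.
pose l := fix l n := if n is n'.+1 then c (l n', k n) else k 0%N.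
have kl n : leI (k n) (l n).
  by case: n => [|n]; [exact: directed_refl dirI _|case: (cP (l n, k n.+1))].
have ndl : nondecreasing_seq (x \o l).
  apply/nondecreasing_seqP => n; apply: ndx.
  by case: (cP (l n, k n.+1)).
have [||||s sups] := dcA (S := range (x \o l)).
- by move=> _ [n _ <-]; exact: Ax.
- by exists (x (l 0%N)), 0%N.
- exact: card_image_le.
- by exists u => // _ [n _ <-]; apply: ux; exists (l n).
have [As us ls] := sups.
have supTs : sup_in setT (range (T \o (x \o l))) (T s).
  by apply: vhom_sup_seq => // _ [n _ <-]; exact: Ax.
have Tse : T s = e.
  apply: sup_in_unique supTs _; split=> // [_ [n _ <-]|t _ ut].
    by apply: ue; exists (l n).
  apply: lk => // _ [n _ <-]; apply: (@le_trans _ _ (T (x (l n)))).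
    by apply: vhom_le => //; exact/ndx/kl.
  by apply: ut; exists n.
exists l, s; split=> //; last by rewrite Tse.
split=> // [_ [i _ <-]|t At ut].
  by apply: vhom_le_reflect => //; rewrite Tse; apply: ue; exists i.
by apply: ls => // _ [n _ <-]; apply: ut; exists (l n).
Qed.

(* The net consists of the elements of [A], above some [s0] in [S], that lie
   below all upper bounds of [S]. *)
Lemma hom_dedekind_complete : dedekind_complete A.
Proof.
move=> S SA [s0 Ss0] [u Au uS]; have [subA _ _ _] := homT;
  have [_ _ AU _] := subA.
have As0 := SA _ Ss0.
pose P y := [/\ A y, s0 <= y & forall t, A t -> ubound S t -> y <= t].
pose J := {y | P y}.
pose leJ (i j : J) : Prop := sval i <= sval j.
(* Subtracting [s0] makes the net positive, as the countable sup property requires. *)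
pose x (i : J) := sval i - s0.
have mkJ y : S y -> exists i : J, sval i = vjoin y s0.
  move=> Sy; have H : P (vjoin y s0).
    split; [by apply: AU => //; exact: SA|exact: vleUr|].
    by move=> t At ut; rewrite vleUx !ut.
  by exists (exist P _ H).
have [|||||_ [s [[As us ls] _ _]]] := @net_sup J leJ x (u - s0).
- split=> [|i j ij]; last by rewrite vleD2r.
  split; [|by move=> i; exact: lexx|by move=> i j k; exact: le_trans|].
    by have [i _] := mkJ _ Ss0; exact: inhabits i.
  move=> [y [Ay sy hy]] [z [Az sz hz]].
  have H : P (vjoin y z).
    split; [exact: AU|exact: le_trans sy (vleUl _ _)|].
    by move=> t At ut; rewrite vleUx hy// hz.
  by exists (exist P _ H); [exact: vleUl|exact: vleUr].
- by move=> _ [[y [Ay sy hy]] _ <-]; exact: vector_sublatticeB.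
- by move=> [y [Ay sy hy]]; rewrite vsub_ge0.
- exact: vector_sublatticeB.
- by move=> _ [[y [Ay sy hy]] _ <-]; rewrite vleD2r hy.
exists (s + s0); split; first exact: vector_sublatticeD.
  move=> y Sy; have [i iy] := mkJ _ Sy; apply: (le_trans (vleUl y s0)).
  by rewrite -iy -vleBlDr; apply: us; exists i.
move=> t At ut; rewrite -vleBrDr; apply: ls; first exact: vector_sublatticeB.
by move=> _ [[y [Ay sy hy]] _ <-]; rewrite vleD2r hy.
Qed.

Lemma hom_countable_sup_property : countable_sup_property A.
Proof.
move=> I leI x s x0 s0 [netx xA sups]; have [As us _] := sups.
have [l [s' [sups' suplx _]]] := net_sup netx xA x0 As us.
by exists l; rewrite (sup_in_unique sups sups').
Qed.

Lemma hom_order_continuous : order_continuous A T.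
Proof.
move=> I leI x [[dirI ndx] xA [A0 lx infx]].
have [subA linT _ TI] := homT; have [_ _ _ AI] := subA.
have Ax i : A (x i) by apply: xA; exists i.
have x0 i : 0 <= x i by apply: lx; exists i.
have [i0] := directed_inhabited dirI.
(* Fixing [i0] and truncating at [x i0] turns the decreasing net into an increasing one that is
   positive and bounded, with supremum [x i0]. The truncation handles indices not above [i0]. *)
pose y i := x i0 - vmeet (x i0) (x i).
have [|||||l [s [sups _ supT]]] := @net_sup I leI y (x i0).
- split=> // i j ij; rewrite vleD2l vleN2; apply: vleI2 => //; exact: ndx.
- by move=> _ [i _ <-]; apply: vector_sublatticeB => //; exact: AI.
- by move=> i; rewrite vsub_ge0 vleIl.
- exact: Ax.
- by move=> _ [i _ <-]; rewrite vleBlDr -[leLHS]addr0 vleD2l vlexI !x0.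
have sx : s = x i0.
  apply: sup_in_unique sups _; split; first exact: Ax.
    by move=> _ [i _ <-]; rewrite vleBlDr -[leLHS]addr0 vleD2l vlexI !x0.
  move=> t At ut; rewrite -[leRHS]add0r -vleBlDr; apply: infx.
    exact: vector_sublatticeB.
  move=> _ [i _ <-]; apply: le_trans (vleIr (x i0) _).
  by rewrite vleBlDr addrC -vleBlDr; apply: ut; exists i.
split; [split=> // i j ij|by []|].
  by apply: vhom_le => //; exact: ndx.
split=> // [_ [i _ <-]|t _ tl].
  by rewrite /= -vhom0; apply: vhom_le.
have [_ _ lT] := supT; rewrite -(vleD2l (T s)) addr0 -vleBrDr.
apply: lT => // _ [i _ <-]; rewrite /= (vhomB linT)//; last exact: AI.
rewrite sx vleD2l vleN2 TI// vlexI.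
by apply/andP; split; apply: tl; [exists i0|exists i].
Qed.

End injective_homs.

(** * The quotient space *)

Section quotient.
Context d (X : measurableType d) (R : realType) (E : vectorLatticeType R).
Hypothesis hE : sigma_dedekind_complete [set: E].
Variable mu : vmeasure X E.
Implicit Types (f g h : {mfun X >-> R}) (u v : L0 mu).

Local Notation pi f := (\pi_(L0 mu)%qT f).

Lemma L0_leE f g :
  (pi f <= pi g) <-> valmost_everywhere mu (fun x => f x <= g x).
Proof. by split=> /L0_leP. Qed.

Lemma L0_joinpi f g : vjoin (pi f) (pi g) = pi (vjoin f g).
Proof. exact: L0_joinE. Qed.

Lemma L0_meetpi f g : vmeet (pi f) (pi g) = pi (vmeet f g).
Proof. exact: L0_meetE. Qed.

Lemma L0_pi0 : pi 0 = 0. Proof. by []. Qed.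

Lemma calN_sub f g : pi f = pi g <-> calN mu (f - g).
Proof.
rewrite -L0_eqP; split; apply: vae_imp => x.
  by move=> fg; change (f x - g x = 0); rewrite fg subrr.
by move=> fg0; apply: subr0_eq; exact: fg0.
Qed.

(** The difference [g - f] vanishes almost everywhere, hence is integrable with integral [0]. *)
Lemma Iint_pi f g : calL1 mu f -> pi g = pi f ->
  calL1 mu g /\ Iint mu g = Iint mu f.
Proof.
move=> fL /calN_sub/(calN_calL1 hE)[gfL gf0].
have -> : g = 1 *: (g - f) + f by rewrite scale1r subrK.
split; last by rewrite Iint_linear// gf0 scaler0 add0r.
by apply: calL1D => //; rewrite scale1r.
Qed.

Lemma L1_pi f : L1 mu (pi f) <-> calL1 mu f.
Proof.
split=> [[g gL gf]|fL]; last by exists f.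
by have [] := Iint_pi gL (esym gf).
Qed.

Lemma Iint_ae_pi f : calL1 mu f -> Iint_ae mu (pi f) = Iint mu f.
Proof.
by move=> fL; rewrite /Iint_ae; have [] := Iint_pi fL (reprK (pi f)).
Qed.

Lemma vector_sublattice_L1 : vector_sublattice (L1 mu).
Proof.
have [A0 AD AU AI] := vector_sublattice_calL1 hE mu; split.
- by rewrite -L0_pi0; exact/L1_pi.
- move=> a _ _ [f fL <-] [g gL <-]; rewrite L0_piZ L0_piD; exact/L1_pi/AD.
- by move=> _ _ [f fL <-] [g gL <-]; rewrite L0_joinpi; exact/L1_pi/AU.
- by move=> _ _ [f fL <-] [g gL <-]; rewrite L0_meetpi; exact/L1_pi/AI.
Qed.

Lemma calL1_sandwich f g h : calL1 mu f -> calL1 mu h ->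
  (forall x, f x <= g x) -> (forall x, g x <= h x) -> calL1 mu g.
Proof.
move=> fL hL fg gh.
have := calL1D hE (calL1_abs hE fL) (calL1_abs hE hL).
move=> /(calL1_dominated hE); apply => x.
apply: le_trans (ler_norm _).
change (`|g x| <= Num.max (f x) (- f x) + Num.max (h x) (- h x));
  rewrite !maxrN.
rewrite ler_norml; apply/andP; split.
  rewrite lerNl (le_trans (_ : - g x <= - f x)) ?lerN2//.
  by rewrite (le_trans (ler_norm _))// normrN lerDl.
by rewrite (le_trans (gh x))// (le_trans (ler_norm _))// lerDr.
Qed.

Lemma Iint_le f g : calL1 mu f -> calL1 mu g -> (forall x, f x <= g x) ->
  Iint mu f <= Iint mu g.
Proof.
move=> fL gL fg; rewrite -vsub_ge0 -(vhomB (Iint_linear hE (mu := mu)))//.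
apply: (Iint_ge0 hE) => [|x].
  by apply: vector_sublatticeB => //; exact: vector_sublattice_calL1.
by change (0 <= g x - f x); rewrite subr_ge0.
Qed.

(** The pointwise supremum is measurable as a limit. Its minimality is stated point by point so that
    it can be used off a null set. *)
Lemma mfun_increasing_limit (F : nat -> {mfun X >-> R}) g :
  (forall x, nondecreasing_seq (F ^~ x)) -> (forall n x, F n x <= g x) ->
  exists s : {mfun X >-> R}, [/\ forall x, F n x @[n --> \oo] --> s x,
    forall n x, F n x <= s x
  & forall x a, (forall n, F n x <= a) -> s x <= a].
Proof.
move=> ndF Fg; pose s x := sup (range (F ^~ x)).
have cvgs x : F n x @[n --> \oo] --> s x.
  by apply: nondecreasing_cvgn => //; exists (g x) => _ [n _ <-].
have ms : measurable_fun setT s.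
  by apply: (measurable_fun_cvg (h := F)).
exists (mfun_Sub (mem_set ms)); split=> //.
  by move=> n x; apply: ub_le_sup; [exists (g x) => _ [m _ <-]|exists n].
by move=> x a Fa; apply: ge_sup => [|_ [n _ <-]//]; exists (F 0%N x), 0%N.
Qed.

Lemma countable_range (T : choiceType) (S : set T) : S !=set0 -> countable S ->
  exists s : nat -> T, range s = S.
Proof.
move=> [y0 Sy0] /countable_injP[i inji].
(* Numbers that are not codes of elements of [S] are sent to the default [y0], which lies in [S]. *)
pose s n := xget y0 [set y | S y /\ i y = n].
have Ss n : S (s n).
  rewrite /s; case: xgetP => [y _ []//|]; by [].
exists s; apply/seteqP; split=> [_ [n _ <-]//|y Sy].
exists (i y) => //; rewrite /s; case: xgetP => [z _ [Sz iz]|/(_ y)[]//].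
by apply: inji; rewrite ?inE.
Qed.

(** The supremum is the class of the pointwise limit of running maxima of representatives,
    integrable because it lies between two integrable functions. *)
Lemma L1_sigma_dedekind_complete : sigma_dedekind_complete (L1 mu).
Proof.
move=> S SL S0 cS [_ [g gL <-] gS].
have [s rs] := countable_range S0 cS.
have Ss n : S (s n) by rewrite -rs; exists n.
pose r n : {mfun X >-> R} := repr (s n).
have pir n : pi (r n) = s n by exact: reprK.
(* Cutting [r n] at [g] changes it on a null set only and makes the bound hold everywhere, so that
   the pointwise suprema are finite. *)
pose F := fix F n := if n is n'.+1 then vjoin (F n') (vmeet (r n) g)
                     else vmeet (r 0%N) g.
have rF n : vmeet (r n) g <= F n by case: n => [|n] /=;
  [exact: lexx|exact: vleUr].
have ndF x : nondecreasing_seq (F ^~ x).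
  by apply/nondecreasing_seqP => n;
    have /mfun_leP := vleUl (F n) (vmeet (r n.+1) g).
have Fle h : (forall n, vmeet (r n) g <= h) -> forall n, F n <= h.
  by move=> rh; elim=> [|n IH] /=; rewrite ?vleUx ?IH ?rh.
have Fg n x : F n x <= g x.
  by apply/mfun_leP: x; apply: Fle => m; exact: vleIr.
have [sF [cvgF Fs sle]] := mfun_increasing_limit ndF Fg.
have rL n : calL1 mu (r n) by apply/L1_pi; rewrite pir; exact/SL.
have F0L : calL1 mu (F 0%N).
  by have [_ _ _] := vector_sublattice_calL1 hE mu; apply.
have sL : calL1 mu sF.
  by apply: (calL1_sandwich F0L gL) => [|x]; [exact: Fs|exact: sle].
exists (pi sF); split; first exact/L1_pi.
  rewrite -rs => _ [n _ <-]; rewrite -pir; apply/L0_leE.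
  have : s n <= pi g by apply: gS.
  rewrite -pir => /L0_leE; apply: vae_imp => x rgx.
  apply: le_trans (Fs n x); have /mfun_leP/(_ x) := rF n; apply: le_trans.
  by change (r n x <= Num.min (r n x) (g x)); rewrite le_min lexx.
move=> _ [h hL <-] hS; apply/L0_leE.
have : forall n, valmost_everywhere mu (fun x => r n x <= h x).
  by move=> n; apply/L0_leE; rewrite pir; apply: hS.
(* The countably many exceptional sets are merged into one null set. *)
move/vae_all; apply: vae_imp => x rh; apply: sle => n.
have min_le m : Num.min (r m x) (g x) <= h x by rewrite ge_min rh.
elim: n => [|n IH]; first exact: min_le.
by change (Num.max (F n x) (Num.min (r n.+1 x) (g x)) <= h x);
  rewrite ge_max IH min_le.
Qed.

(** Choose representatives [m n] that are positive and decreasing everywhere, and let [s] be the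
    limit of [F n = m 0 - m n]. The class of [m 0 - s] is below every [x n], hence zero, and
    monotone convergence for [F] gives the claim. *)
Lemma L1_sigma_order_continuous : sigma_order_continuous (L1 mu) (Iint_ae mu).
Proof.
move=> x [[_ decx] xL [_ x_ge0 infx]].
have xn0 n : 0 <= x n by apply: x_ge0; exists n.
pose r n : {mfun X >-> R} := vjoin (repr (x n)) 0.
have pir n : pi (r n) = x n.
  by rewrite -L0_joinpi reprK L0_pi0 vjoin_l.
(* Running minima decrease at every point and stay in the class [x n], because the [x n]
   decrease. *)
pose m := fix m n := if n is n'.+1 then vmeet (m n') (r n) else r 0%N.
have pim n : pi (m n) = x n.
  elim: n => [|n IH] /=; first exact: pir.
  by rewrite -L0_meetpi IH pir vmeetC vmeet_l// decx.
have r_ge0 n : 0 <= r n by exact: vleUr.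
have m_ge0 n : 0 <= m n by elim: n => [|n IH] /=; rewrite ?vlexI ?IH /=;
  exact: r_ge0.
have m_le n : m n.+1 <= m n by exact: vleIl.
have mL n : calL1 mu (m n) by apply/L1_pi; rewrite pim; apply: xL; exists n.
pose F n := m 0%N - m n.
have FL n : calL1 mu (F n).
  by apply: vector_sublatticeB => //; exact: vector_sublattice_calL1.
have ndF y : nondecreasing_seq (F ^~ y).
  apply/nondecreasing_seqP => n; have /mfun_leP/(_ y) := m_le n.
  by move=> h; change (m 0%N y - m n y <= m 0%N y - m n.+1 y);
    rewrite lerD2l lerN2.
have F_le n y : F n y <= m 0%N y.
  change (m 0%N y - m n y <= m 0%N y); rewrite gerBl.
  by have /mfun_leP/(_ y) := m_ge0 n.
have F_ge0 n y : 0 <= F n y.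
  apply: le_trans (ndF y 0%N n (leq0n n)).
  by change (0 <= m 0%N y - m 0%N y); rewrite subrr.
have [s [cvgF Fs sle]] := mfun_increasing_limit ndF F_le.
have s_ge0 y : 0 <= s y by apply: le_trans (F_ge0 0%N y) (Fs 0%N y).
have sm y : s y <= m 0%N y by exact: sle.
have sL : calL1 mu s.
  by apply: (calL1_sandwich (FL 0%N) (mL 0%N)) => // y; exact: Fs.
have Is : Iint mu s = Iint mu (m 0%N).
  have /calN_sub : pi (m 0%N - s) = pi 0.
    apply/le_anti/andP; split; last first.
      apply/L0_leE/vae_true => y.
      by change (0 <= m 0%N y - s y); rewrite subr_ge0.
    apply: infx.
      apply/L1_pi; apply: vector_sublatticeB => //;
        exact: vector_sublattice_calL1.
    move=> _ [n _ <-]; rewrite -pim; apply/L0_leE/vae_true => y.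
    change (m 0%N y - s y <= m n y); rewrite lerBlDr -lerBlDl.
    exact: Fs.
  by rewrite subr0 => /calN_sub ms; have [_ ->] := Iint_pi sL ms.
have supF : sup_in setT (range (fun n => Iint mu (F n))) (Iint mu (m 0%N)).
  rewrite -Is; apply/ext_sup_Fin.
  have FE f : (forall y, 0 <= f y) -> calL1 mu f -> oint mu f = Fin (Iint mu f).
    by move=> f0 /(calL1_ge0 hE mu f0)[a fa]; rewrite (Iint_ge0E hE f0 fa).
  rewrite -FE//; under eq_fun do rewrite -FE//.
  exact: oint_monotone_convergence.
have Ix n : Iint_ae mu (x n) = Iint mu (m n) by rewrite -pim Iint_ae_pi.
have m0E n : Iint mu (F n) = Iint mu (m 0%N) - Iint mu (m n).
  by rewrite (vhomB (Iint_linear hE (mu := mu))).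
split; [split; first exact: directed_nat|by []|split=> //].
- move=> i j ij; rewrite /= !Ix -vleN2 -(vleD2l (Iint mu (m 0%N))) -!m0E.
  by apply: Iint_le => // y; exact: ndF.
- move=> _ [n _ <-]; rewrite /= Ix; apply: (Iint_ge0 hE) => // y.
  by have /mfun_leP/(_ y) := m_ge0 n.
move=> t _ tl; have [_ _ lF] := supF.
rewrite -(vleD2l (Iint mu (m 0%N))) addr0 -vleBrDr; apply: lF => // _ [n _ <-].
by rewrite m0E vleD2l vleN2 -Ix; apply: tl; exists n.
Qed.

Hypothesis homI : vector_lattice_hom (calL1 mu) (Iint mu).

(** A homomorphism killing [f] maps its positive part to the join of [0] with [0]; a positive
    function of zero integral vanishes almost everywhere. The same holds for [- f]. *)
Lemma Iint_kernel : calL1 mu `&` [set f | Iint mu f = 0] = calN mu.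
Proof.
apply/seteqP; split=> [f [fL /= f0]|f /(calN_calL1 hE)//].
have [subL linI IU _] := homI; have [L0 _ LU _] := subL.
have pos0 g : calL1 mu g -> Iint mu g = 0 ->
    valmost_everywhere mu (fun x => vjoin g 0 x = 0).
  move=> gL g0;
  have Ig : Iint mu (vjoin g 0) = 0.
    by rewrite IU// g0 (vhom0 homI) vjoin_l.
  apply/(oint_eq0 mu hE (mfun_pos_ge0 g)).
  have [a ga] := (calL1_ge0 hE mu (mfun_pos_ge0 g)).1 (LU _ _ gL L0).
  by move: Ig; rewrite (Iint_ge0E hE (mfun_pos_ge0 g) ga) => a0; rewrite ga a0.
have NfL : calL1 mu (- f) by rewrite -scaleN1r; apply: calL1Z.
have Nf0 : Iint mu (- f) = 0.
  by rewrite -[- f]addr0 -scaleN1r linI// f0 scaler0 (vhom0 homI) addr0.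
apply: vae_imp (vae_and (pos0 _ fL f0) (pos0 _ NfL Nf0)) => x [fx Nfx].
by rewrite mfun_pos_sub_neg fx Nfx subrr.
Qed.

Lemma Iint_ae_hom : vector_lattice_hom (L1 mu) (Iint_ae mu).
Proof.
have [[L0 LD LU LI] linI IU II] := homI; split;
  first exact: vector_sublattice_L1.
- move=> a _ _ [f fL <-] [g gL <-]; rewrite L0_piZ L0_piD !Iint_ae_pi ?linI//.
  exact: LD.
- by move=> _ _ [f fL <-] [g gL <-]; rewrite L0_joinpi !Iint_ae_pi ?IU//;
    exact: LU.
- by move=> _ _ [f fL <-] [g gL <-]; rewrite L0_meetpi !Iint_ae_pi ?II//;
    exact: LI.
Qed.

Lemma Iint_ae_inj : set_inj (L1 mu) (Iint_ae mu).
Proof.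
move=> u v /set_mem[f fL <-] /set_mem[g gL <-]; rewrite !Iint_ae_pi// => fg.
apply/calN_sub; rewrite -Iint_kernel; split=> /=.
  by apply: vector_sublatticeB => //; exact: vector_sublattice_calL1.
by rewrite (vhomB (Iint_linear hE (mu := mu)))// fg subrr.
Qed.

End quotient.

(** * Assembly of the equivalences and their consequences *)

Theorem proposition4p1 (R : realType) (d : measure_display)
    (X : measurableType d) (E : vectorLatticeType R)
    (hE : sigma_dedekind_complete [set: E]) (mu : vmeasure X E) :
  let c1 := vector_lattice_hom (calL1 mu) (Iint mu) in
  let c2 := forall (D1 D2 : set X) (e1 e2 : E), measurable D1 -> measurable D2 ->
    mu D1 = Fin e1 -> mu D2 = Fin e2 -> mu (D1 `&` D2) = Fin (vmeet e1 e2) in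
  let c3 := forall (D1 D2 : set X) (e1 e2 : E), measurable D1 -> measurable D2 ->
    mu D1 = Fin e1 -> mu D2 = Fin e2 -> mu (D1 `|` D2) = Fin (vjoin e1 e2) in
  let c4 := vector_lattice_hom (bounded_mfun X R) (Iint mu) in
  [/\ (c1 <-> c2) /\ (c1 <-> c3),
      ext_finite (mu [set: X]) -> (c1 <-> c4),
      c1 ->
        [/\ calL1 mu `&` [set f | Iint mu f = 0] = calN mu,
            vector_lattice_hom (L1 mu) (Iint_ae mu),
            set_inj (L1 mu) (Iint_ae mu),
            sigma_dedekind_complete (L1 mu)
          & sigma_order_continuous (L1 mu) (Iint_ae mu)]
    & c1 -> monotone_complete [set: E] -> countable_sup_property [set: E] ->
        [/\ dedekind_complete (L1 mu),
            countable_sup_property (L1 mu)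
          & order_continuous (L1 mu) (Iint_ae mu)]].
Proof.
move=> c1 c2 c3 c4.
have c12 : c1 -> c2 by apply: vector_lattice_hom_meet => // D mD;
  exact: calL1_indic.
have c21 : c2 -> c1 by exact: vmeas_meet_hom.
have [c23 c32] : c2 <-> c3 by exact: vmeas_meet_join.
split.
- by split; split=> // [/c12/c23|/c32/c21].
- move=> muT; split=> [[_ linI IU II]|c4h].
    (* For finite [mu] bounded functions are integrable, so [c4] is a restriction of [c1];
       conversely, indicators are bounded, so [c4] yields [c2]. *)
    have BL := bounded_calL1 hE muT.
    split; first exact: vector_sublattice_bounded.
    + by move=> a f g /BL fL /BL gL; exact: linI.
    + by move=> f g /BL fL /BL gL; exact: IU.
    + by move=> f g /BL fL /BL gL; exact: II.
  apply: c21; apply: vector_lattice_hom_meet c4h => // D mD _.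
  exact: bounded_indic.
- move=> homI; split.
  + exact: Iint_kernel.
  + exact: Iint_ae_hom.
  + exact: Iint_ae_inj.
  + exact: L1_sigma_dedekind_complete.
  + exact: L1_sigma_order_continuous.
- move=> homI mcE cspE.
  have homJ := Iint_ae_hom hE homI; have injJ := Iint_ae_inj hE homI.
  have dcL : sigma_dedekind_complete (L1 mu)
    by exact: L1_sigma_dedekind_complete.
  have scL : sigma_order_continuous (L1 mu) (Iint_ae mu)
    by exact: L1_sigma_order_continuous.
  split.
  + exact: hom_dedekind_complete homJ injJ dcL scL mcE cspE.
  + exact: hom_countable_sup_property homJ injJ dcL scL mcE cspE.
  + exact: hom_order_continuous homJ injJ dcL scL mcE cspE.
Qed.
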